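(* Let $n\ge1$, let $\mathcal{I}^2_n$ be the ideal of $\mathbb{Q}[x_1,y_1,\dots,x_n,y_n]$ generated by all $B$-quasisymmetric polynomials with zero constant term, and let $\mathcal{Q}_n=\mathbb{Q}[x_1,y_1,\dots,x_n,y_n]/\mathcal{I}^2_n$. Then the images of the monomials in $$\mathcal{B}_n=\{x_1^{v_1}y_1^{v_2}\cdots x_n^{v_{2n-1}}y_n^{v_{2n}} \;:\; v=(v_1,\dots,v_{2n})\in\mathbb{Z}_{\ge0}^{2n} \text{ is 2-Dyck}\}$$ form a basis of $\mathcal{Q}_n$; consequently $\dim\mathcal{Q}_n=\frac{1}{2n+1}\binom{3n}{n}$. Moreover, $\mathcal{I}^2_n$ is bihomogeneous, so $\mathcal{Q}_n$ is bigraded by (degree in the $x$'s, degree in the $y$'s), and the subspace $\mathbf{H}_{k,l}(\mathcal{Q}_n)$ of elements of bidegree $(k,l)$ satisfies $$\dim \mathbf{H}_{k,l}(\mathcal{Q}_n)=\binom{n+k-1}{k}\binom{n+l-1}{l}\frac{n-k-l}{n}.$$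
   Context: A bivector of size $k$ is a vector $c=(c_1,\dots,c_{2k})$ of nonnegative integers; a bicomposition is a bivector with no two consecutive entries both $0$ (the empty one allowed). Write $|c|=\sum c_j$. For a bicomposition $c$ of size $k$, $F_c(x_1,y_1,\dots,x_n,y_n)=\sum\prod_{r=1}^{|c|}z_r$, where positions $1,\dots,|c|$ are split into consecutive runs of lengths $c_1,\dots,c_{2k}$, runs $2t-1,2t$ forming block $t$; the sum runs over $1\le m_1\le\dots\le m_{|c|}\le n$ with $m_r<m_{r+1}$ whenever $r$ is the last position of a block, and $z_r=x_{m_r}$ (resp. $y_{m_r}$) if $r$ is in an odd-indexed (resp. even-indexed) run; $F_c=0$ if $k>n$, $F_\emptyset=1$. $B$-quasisymmetric polynomials are the elements of the $\mathbb{Q}$-span of the $F_c$. A vector $v=(v_1,\dots,v_{2n})$ of nonnegative integers is called 2-Dyck if $v_1+v_2+\dots+v_{2l}\le l-1$ for every $l=1,\dots,n$ (equivalently, the lattice path starting at $(0,0)$ which, for each entry $v_i$ read left to right, takes $v_i$ steps $(2,0)$ followed by one step $(0,1)$, never enters the region $x>y$... i.e. stays above the diagonal); otherwise $v$ is called transdiagonal.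
   Formalization: The formula for dim H_{k,l}(Q_n) is stated only for k+l ≤ n; for k+l > n, where its right side is negative (e.g. −1 for n=k=l=1) and so cannot be a dimension, H_{k,l}(Q_n) is shown to have dimension 0 instead. *)

(* Defs.v *)
(* Mathematical Components, with multinomials for polynomials in several
   variables and boolp for classical (informative) membership in an ideal. *)
From HB Require Import structures.
From mathcomp Require Import all_boot all_order all_algebra.
From mathcomp Require Import ring_quotient boolp mpoly.

Set Implicit Arguments.
Unset Strict Implicit.
Unset Printing Implicit Defensive.

Import GRing.Theory.

Local Open Scope ring_scope.
Local Open Scope quotient_scope.

Section LinearAlgebra.
Variables (K : fieldType) (V : lmodType K).
Implicit Types (U G : V -> Prop) (d : nat).

Definition in_span G (v : V) : Prop :=
  exists (m : nat) (a : 'I_m -> K) (g : 'I_m -> V),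
    (forall i, G (g i)) /\ v = \sum_(i < m) a i *: g i.

Definition lin_indep (I : eqType) (b : I -> V) : Prop :=
  forall (s : seq I) (a : I -> K), uniq s ->
    \sum_(i <- s) a i *: b i = 0 -> forall i, i \in s -> a i = 0.

Definition is_basis_of U (I : eqType) (b : I -> V) : Prop :=
  [/\ forall i, U (b i), lin_indep b
    & forall u, U u -> in_span (fun v => exists i, v = b i) u].

Definition has_dim U d : Prop := exists b : 'I_d -> V, is_basis_of U b.

Definition subspace U : Prop :=
  U 0 /\ forall (a : K) u v, U u -> U v -> U (a *: u + v).

Definition full_space : V -> Prop := fun=> True.

End LinearAlgebra.

Arguments full_space {K} V.

Definition in_ideal_gen (A : comNzRingType) (G : A -> Prop) (p : A) : Prop :=
  exists (m : nat) (a g : 'I_m -> A),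
    (forall i, G (g i)) /\ p = \sum_(i < m) a i * g i.

Section Polynomials.
Variable n : nat.

(* The 2n variables are listed in the order x_1, y_1, ..., x_n, y_n;
   indices start at 0. *)
Fact xvar_subproof (i : 'I_n) : (i.*2 < n.*2)%N.
Proof. by rewrite ltn_double. Qed.
Fact yvar_subproof (i : 'I_n) : (i.*2.+1 < n.*2)%N.
Proof. by rewrite ltn_Sdouble. Qed.

Definition xvar (i : 'I_n) : 'I_(n.*2) := Ordinal (xvar_subproof i).
Definition yvar (i : 'I_n) : 'I_(n.*2) := Ordinal (yvar_subproof i).

End Polynomials.

Notation Pol n := {mpoly rat[n.*2]}.

(* A bivector of size k is a sequence of 2k natural numbers. *)
Definition bivector (c : seq nat) : bool := ~~ odd (size c).
Definition bvsize (c : seq nat) : nat := (size c)./2.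

Definition bicomposition (c : seq nat) : bool :=
  bivector c && sorted (fun a b => ~~ ((a == 0%N) && (b == 0%N))) c.

Section FundamentalBQSym.
Variables (n : nat) (c : seq nat).

(* Positions, runs and blocks are numbered from 0. [reshape_index c r] is the
   index of the run containing r, when the positions are cut into consecutive
   runs of lengths c_0, c_1, ... (empty runs are skipped). Hence x-runs are
   those of even index, and runs 2t and 2t+1 form block t. *)
Definition run_of (r : nat) : nat := reshape_index c r.
Definition block_of (r : nat) : nat := (run_of r)./2.

Definition admissible (m : {ffun 'I_(sumn c) -> 'I_n}) : bool :=
  [forall r : 'I_(sumn c), forall s : 'I_(sumn c), (s == r.+1 :> nat) ==>
     if block_of r == block_of s then (m r <= m s)%N else (m r < m s)%N].

Definition zvar (r : nat) (i : 'I_n) : Pol n :=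
  if odd (run_of r) then 'X_(yvar i) else 'X_(xvar i).

Definition Fbq : Pol n :=
  if (bvsize c <= n)%N
  then \sum_(m : {ffun 'I_(sumn c) -> 'I_n} | admissible m)
         \prod_(r < sumn c) zvar r (m r)
  else 0.

End FundamentalBQSym.

Definition bqsym (n : nat) : Pol n -> Prop :=
  in_span (fun p : Pol n => exists2 c, bicomposition c & p = Fbq n c).

Definition bqsym0 (n : nat) (p : Pol n) : Prop := bqsym p /\ p@_0%MM = 0.

(* Ideals of ring_quotient are boolean predicates, hence the classical
   reflection of the (existential) membership. *)
Definition bqideal (n : nat) : {pred Pol n} :=
  fun p => `[< in_ideal_gen (@bqsym0 n) p >].

Lemma bqideal_closed n : idealr_closed (@bqideal n).
Proof.
split=> [||a p q].
- by apply/asboolP; exists 0%N, (fun=> 0), (fun=> 0); split=> [[]|]; rewrite ?big_ord0.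
- apply/negP => /asboolP[m [a [g [Gg /(congr1 (mcoeff 0%MM))]]]].
  rewrite raddf_sum big1 ?mcoeff1 ?eqxx => [/eqP|i _]; first by rewrite oner_eq0.
  have [_ g0] := Gg i.
  by apply: etrans ((mcoeff0_is_multiplicative _ _).1 (a i) (g i)) _; rewrite g0 mulr0.
- move=> /asboolP[m [u [g [Gg ->]]]] /asboolP[k [w [h [Gh ->]]]]; apply/asboolP.
  exists (m + k)%N.
  exists (fun i => match split i with inl j => a * u j | inr j => w j end).
  exists (fun i => match split i with inl j => g j | inr j => h j end).
  split=> [i|]; first by case: (split i).
  rewrite big_split_ord /= mulr_sumr; congr (_ + _); apply: eq_bigr => i _.
    by rewrite (unsplitK (inl i)) mulrA.
  by rewrite (unsplitK (inr i)).
Qed.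

HB.instance Definition _ n := isIdealr.Build (Pol n) (@bqideal n) (bqideal_closed n).

Definition Qn (n : nat) : Type := {ideal_quot (@bqideal n)}.

HB.instance Definition _ n := GRing.ComNzRing.on (Qn n).

Definition proj (n : nat) (p : Pol n) : Qn n := \pi_({ideal_quot (@bqideal n)}) p.

Section QuotientModule.
Variable n : nat.

Lemma proj_is_zmod_morphism : zmod_morphism (@proj n).
Proof. by move=> p q; rewrite /proj rmorphB. Qed.

Lemma proj_is_monoid_morphism : monoid_morphism (@proj n).
Proof. by split=> [|p q]; rewrite /proj ?rmorph1 ?rmorphM. Qed.

HB.instance Definition _ :=
  GRing.isZmodMorphism.Build (Pol n) (Qn n) (@proj n) proj_is_zmod_morphism.
HB.instance Definition _ :=
  GRing.isMonoidMorphism.Build (Pol n) (Qn n) (@proj n) proj_is_monoid_morphism.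

Definition scaleQ (a : rat) (q : Qn n) : Qn n := proj a%:MP * q.

Lemma scaleQA a b q : scaleQ a (scaleQ b q) = scaleQ (a * b) q.
Proof. by rewrite /scaleQ mulrA -rmorphM /= mpolyCM. Qed.

Lemma scaleQ1 : left_id 1 scaleQ.
Proof. by move=> q; rewrite /scaleQ rmorph1 mul1r. Qed.

Lemma scaleQDr : right_distributive scaleQ +%R.
Proof. by move=> a p q; rewrite /scaleQ mulrDr. Qed.

Lemma scaleQDl q : {morph scaleQ^~ q : a b / a + b}.
Proof. by move=> a b; rewrite /scaleQ mpolyCD rmorphD mulrDl. Qed.

HB.instance Definition _ := GRing.Zmodule_isLmodule.Build rat (Qn n)
  scaleQA scaleQ1 scaleQDr scaleQDl.

Lemma projZ a (p : Pol n) : proj (a *: p) = a *: proj p.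
Proof. by rewrite -mul_mpolyC rmorphM. Qed.

End QuotientModule.

(* v_1 + ... + v_(2l) <= l - 1 for l = 1, ..., n, with l shifted by one. *)
Definition two_dyck (n : nat) (v : 'X_{1..n.*2}) : bool :=
  [forall l : 'I_n, (\sum_(i < n.*2 | (i < l.+1.*2)%N) v i <= l)%N].

Definition dyck_monomials (n : nat) (v : {v : 'X_{1..n.*2} | two_dyck v}) : Qn n :=
  proj 'X_[val v].

Section Bigrading.
Variable n : nat.

Definition bideg (m : 'X_{1..n.*2}) : nat * nat :=
  ((\sum_(i < n) m (xvar i))%N, (\sum_(i < n) m (yvar i))%N).

Definition bihomog (k l : nat) (p : Pol n) : bool :=
  all (fun m => bideg m == (k, l)) (msupp p).

Definition bihomog_comp (k l : nat) (p : Pol n) : Pol n :=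
  \sum_(m <- msupp p | bideg m == (k, l)) p@_m *: 'X_[m].

Definition bihomog_ideal (J : {pred Pol n}) : Prop :=
  forall p, p \in J -> forall k l, bihomog_comp k l p \in J.

Definition Hbi (k l : nat) (q : Qn n) : Prop :=
  exists2 p : Pol n, bihomog k l p & q = proj p.

(* H makes Qn a bigraded algebra: Qn is the direct sum of the subspaces H k l,
   and the product is additive on bidegrees. *)
Definition is_bigrading (H : nat -> nat -> Qn n -> Prop) : Prop :=
  [/\ forall k l, subspace (H k l),
      forall q, exists (N : nat) (h : nat -> nat -> Qn n),
        (forall k l, H k l (h k l)) /\ q = \sum_(k < N) \sum_(l < N) h k l,
      forall (N : nat) (h : nat -> nat -> Qn n),
        (forall k l, H k l (h k l)) ->
        \sum_(k < N) \sum_(l < N) h k l = 0 ->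
        forall k l, (k < N)%N -> (l < N)%N -> h k l = 0,
      H 0%N 0%N 1
    & forall k l k' l' p q,
        H k l p -> H k' l' q -> H (k + k')%N (l + l')%N (p * q)].

End Bigrading.

(* Main.v *)
From HB Require Import structures.
Require Import Defs.
From mathcomp Require Import all_boot all_order all_algebra.
From mathcomp Require Import ring_quotient boolp mpoly.
From mathcomp Require Import ring.

Set Implicit Arguments.
Unset Strict Implicit.
Unset Printing Implicit Defensive.

Import GRing.Theory.

Local Open Scope ring_scope.

(** List the variables as z_1 = x_1, z_2 = y_1, ..., z_(2n) = y_n, and let R_i
    be the substitution z_i = z_(i+1) = 0 followed by a shift that renumbers the
    remaining variables.  All R_i agree on a B-quasisymmetric polynomial and
    send F_c in 2n + 2 variables to F_c in 2n variables.

    Linear independence.  The divided differences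
    T_i f = (R_(i+1) f - R_i f) / z_i satisfy the twisted Leibniz rule
    T_i (f g) = T_i f * R_(i+1) g + R_i f * T_i g, so they map the ideal of
    level n + 1 into the ideal of level n; they also map each 2-Dyck monomial to
    0 or, up to sign, to a 2-Dyck monomial.  By induction on n, a combination of
    2-Dyck monomials lying in the ideal is killed by all the T_i.  Its
    coefficients are then unchanged when the first letter of a monomial moves
    two places to the left, and since z_1, z_2 do not occur in it, it is
    constant, hence 0.

    Spanning.  Write F_c^k for F_c in the variables z_(k+1), ..., z_(2n).  Since
    F_((a+1)c)^k = z_(k+1) F_(ac)^k + F_((a+1)c)^(k+2), one has, modulo monomials
    whose exponents start with a lexicographically smaller word,
    z^w F_(ac)^k = z^(wa) F_c^(k+1) and
    z^(w00) F_((a+1)c)^(k+2) = z^w F_((a+1)c)^k - z_(k+1) z^w F_(ac)^k.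
    Starting from w empty, every word v = wc violating the 2-Dyck condition is
    reached, so z^v is congruent to a combination of lexicographically smaller
    monomials.

    Dimensions.  Removing the last pair of entries of a 2-Dyck vector gives a
    recurrence which is solved by hockey-stick sums of multiset numbers. *)

(** * Fundamental polynomials over an alternating list of variables *)

Definition no00 (c : seq nat) : bool :=
  sorted (fun a b => ~~ ((a == 0%N) && (b == 0%N))) c.

Lemma no00_behead a c : no00 (a :: c) -> no00 c.
Proof. exact: path_sorted. Qed.

Lemma no00_consS a b c : no00 (a :: c) -> no00 (b.+1 :: c).
Proof. by case: c => //= d c /andP[_ ->]. Qed.

Section WordPolynomials.
Variable A : comNzRingType.
Implicit Types (c : seq nat) (s : seq A).

(* [wordpoly c s] is the fundamental B-quasisymmetric polynomial of c in the
   alternating list of variables s: the first variable is either used once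
   more, or skipped together with its successor, which has the other colour. *)
Fixpoint wordpoly c s {struct s} : A :=
  match s, c with
  | [::], _ => (sumn c == 0%N)%:R
  | x :: s', [::] => 1
  | x :: s', a :: c' =>
      (fix wpa a := match a with
        | 0%N => wordpoly c' s'
        | a'.+1 => x * wpa a' +
            (if s' is _ :: s'' then wordpoly (a'.+1 :: c') s'' else 0)
        end) a
  end.

Lemma wordpoly_nil s : wordpoly [::] s = 1.
Proof. by case: s. Qed.

(** Closing a run drops one variable: x_m gives way to y_m inside a block, where equal indices are
    allowed, and y_m to x_(m+1) between blocks, which encodes the strict increase. *)
Lemma wordpoly_cons0 c s : wordpoly (0%N :: c) s = wordpoly c (behead s).
Proof. by case: s. Qed.

Lemma wordpoly_consS a c x s :
  wordpoly (a.+1 :: c) (x :: s) =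
  x * wordpoly (a :: c) (x :: s) + wordpoly (a.+1 :: c) (behead s).
Proof. by case: s. Qed.

Lemma wordpoly_nilr c : wordpoly c [::] = (sumn c == 0%N)%:R.
Proof. by []. Qed.

Arguments wordpoly : simpl never.

(** Lets words of odd length stand for bicompositions, whose length is even. *)
Lemma wordpoly_rcons0 c s : wordpoly (rcons c 0%N) s = wordpoly c s.
Proof.
elim/ltn_ind: {s}(size s) {-2}s (erefl (size s)) c => k IH [_|x s sz] c.
  by rewrite !wordpoly_nilr sumn_rcons addn0.
case: c => [|a c]; first by rewrite wordpoly_cons0 !wordpoly_nil.
rewrite rcons_cons; elim: a => [|a IHa].
  by rewrite !wordpoly_cons0; apply: IH (erefl _) _; rewrite -sz.
rewrite !wordpoly_consS IHa -rcons_cons (IH (size (behead s))) //.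
by rewrite -sz size_behead ltnS leq_pred.
Qed.

(** A nonempty run that meets a zero variable can only skip it with its successor; an empty run
    followed by a nonempty one passes the two zeros with the same effect. Two adjacent empty runs
    would use up both zeros, hence [no00]. *)
Lemma wordpoly_del00 c s1 s2 : no00 c ->
  wordpoly c (s1 ++ [:: 0, 0 & s2]) = wordpoly c (s1 ++ s2).
Proof.
elim/ltn_ind: {s1}(size s1) {-2}s1 (erefl (size s1)) c => k IH s1 sz [|a c].
  by rewrite !wordpoly_nil.
case: s1 sz => [_|x s1 sz] /= cP.
  case: a cP => [|a] cP; last by rewrite wordpoly_consS mul0r add0r.
  rewrite wordpoly_cons0 wordpoly_cons0 [behead (0 :: _)]/=.
  case: c cP => [|[|b] c] // _; first by rewrite !wordpoly_nil.
  by rewrite wordpoly_consS mul0r add0r.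
elim: a cP => [|a IHa] cP.
  by rewrite !wordpoly_cons0; apply: IH (erefl _) _ (no00_behead cP); rewrite -sz.
rewrite !wordpoly_consS; congr (_ * _ + _).
  case: a IHa {cP} (cP : no00 (a.+1 :: c)) => [IH0 cP|a IHa cP]; last first.
    exact/IHa/(no00_consS _ cP).
  by rewrite !wordpoly_cons0; apply: IH (erefl _) _ (no00_behead cP); rewrite -sz.
case: s1 sz {IHa} => [_|y s1 sz] /=; first by rewrite wordpoly_consS mul0r add0r.
by rewrite (IH (size s1)) // -sz ltnS leqnSn.
Qed.

(** Each run uses up a variable, and of the two or more runs left on the empty list one is nonempty.
    This matches the convention F_c = 0 for bicompositions that are too long. *)
Lemma wordpoly_small c s :
  no00 c -> (size s + 1 < size c)%N -> wordpoly c s = 0.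
Proof.
elim/ltn_ind: {s}(size s) {-2}s (erefl (size s)) c => k IH [_|x s sz] c.
  by case: c => [|[|a] [|[|b] c]].
case: c => [|a c] //= cP szc.
have IH0: wordpoly c s = 0.
  by apply: IH (erefl _) _ (no00_behead cP) _; rewrite -?sz.
elim: a cP => [|a IHa] cP; first by rewrite wordpoly_cons0.
rewrite wordpoly_consS.
have -> : wordpoly (a.+1 :: c) (behead s) = 0.
  apply: (IH (size (behead s))) => //.
    by rewrite -sz size_behead ltnS leq_pred.
  by rewrite (leq_ltn_trans _ szc) // leq_add2r size_behead (leq_trans (leq_pred _)).
rewrite addr0; case: a IHa {cP} (cP : no00 (a.+1 :: c)) => [_ _|a IHa cP].
  by rewrite wordpoly_cons0 IH0 mulr0.
by rewrite (IHa (no00_consS _ cP)) mulr0.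
Qed.

End WordPolynomials.

Arguments wordpoly : simpl never.

Lemma wordpoly_map (A B : comNzRingType) (f : {rmorphism A -> B}) c (s : seq A) :
  wordpoly c (map f s) = f (wordpoly c s).
Proof.
elim/ltn_ind: {s}(size s) {-2}s (erefl (size s)) c => k IH [_|x s sz] c.
  by rewrite !wordpoly_nilr rmorph_nat.
case: c => [|a c]; first by rewrite !wordpoly_nil rmorph1.
elim: a => [|a IHa].
  by rewrite !wordpoly_cons0; apply: IH (erefl _) _; rewrite -sz.
rewrite [map f _]/= !wordpoly_consS rmorphD rmorphM /= -IHa /= behead_map.
by rewrite (IH (size (behead s))) // -sz size_behead ltnS leq_pred.
Qed.

Lemma reshape_index_cons a c r :
  reshape_index (a :: c) r = if (r < a)%N then 0%N else (reshape_index c (r - a)).+1.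
Proof.
rewrite /reshape_index /= subn_eq0; case: ltnP => // le_ar.
by rewrite subSn.
Qed.

(** * Admissible sums expanded from the first position *)

Section AdmissibleSums.
Variables (A : comNzRingType) (n : nat) (z : bool -> 'I_n -> A).
Implicit Types (s L p : nat) (rho : nat -> nat).

Definition adm s rho (m : {ffun 'I_s -> 'I_n}) : bool :=
  [forall r : 'I_s, forall t : 'I_s, (t == r.+1 :> nat) ==>
     if (rho r)./2 == (rho t)./2 then (m r <= m t)%N else (m r < m t)%N].

(** The lower bound [L] and the arbitrary run function [rho] make the family closed under removal of
    the first position. *)
Definition adm_sum s rho L : A :=
  \sum_(m : {ffun 'I_s -> 'I_n} | adm rho m && [forall r, (L <= m r)%N])
    \prod_(r < s) z (odd (rho r)) (m r).

Definition fcons s (im : 'I_n * {ffun 'I_s -> 'I_n}) : {ffun 'I_s.+1 -> 'I_n} :=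
  [ffun r => oapp im.2 im.1 (unlift ord0 r)].

Lemma fcons0 s im : @fcons s im ord0 = im.1.
Proof. by rewrite ffunE unlift_none. Qed.

Lemma fconsS s im r : @fcons s im (lift ord0 r) = im.2 r.
Proof. by rewrite ffunE liftK. Qed.

Lemma fcons_bij s : bijective (@fcons s).
Proof.
exists (fun m : {ffun 'I_s.+1 -> 'I_n} =>
    (m ord0, [ffun r : 'I_s => m (lift ord0 r)])) => [[i m]|m].
  by congr (_, _); [rewrite fcons0 | apply/ffunP=> r; rewrite ffunE fconsS].
apply/ffunP=> r; case: (unliftP ord0 r) => [j|] ->; last by rewrite fcons0.
by rewrite fconsS ffunE.
Qed.

Lemma adm_ge s rho (m : {ffun 'I_s.+1 -> 'I_n}) r : adm rho m -> (m ord0 <= m r)%N.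
Proof.
move=> /forallP mP; case: r => r; elim: r => [|r IHr] lt_r.
  by apply: eq_leq; congr (val (m _)); apply: val_inj.
have := forallP (mP (Ordinal (ltnW lt_r))) (Ordinal lt_r).
rewrite /= eqxx /=; have := IHr (ltnW lt_r).
by move=> le1; case: ifP => _ => [|/ltnW]; apply: leq_trans.
Qed.

(** Indices increase weakly, so the condition between positions 0 and 1 is a lower bound on all
    later indices, raised by one if a block ends at position 0. *)
Lemma adm_fcons s rho i (m : {ffun 'I_s -> 'I_n}) :
  adm rho (fcons (i, m)) =
  adm (rho \o S) m &&
    [forall r, (i + ((rho 0)./2 != (rho 1)./2) <= m r)%N].
Proof.
apply/idP/andP => [mP|[/forallP mP /forallP iP]].
  have m'P : adm (rho \o S) m.
    apply/forallP=> r; apply/forallP=> t; apply/implyP=> /eqP def_t.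
    have := forallP (forallP mP (lift ord0 r)) (lift ord0 t).
    by rewrite !fconsS /= /bump /= !add1n def_t eqxx.
  split=> //; apply/forallP=> r; case: s m mP m'P r => [|s] m mP m'P r; first by case: r.
  apply: leq_trans (adm_ge r m'P).
  have := forallP (forallP mP ord0) (lift ord0 ord0).
  by rewrite fconsS fcons0 /=; case: eqP => _ /=; rewrite ?addn0 ?addn1.
apply/forallP=> r; apply/forallP=> t; apply/implyP.
case: (unliftP ord0 t) => [t'|] -> //; case: (unliftP ord0 r) => [r'|] ->.
  rewrite !fconsS /= /bump /= !add1n eqSS => def_t.
  by have /implyP/(_ def_t) := forallP (mP r') t'.
rewrite fcons0 fconsS /= => /eqP[]; rewrite add0n => t0.
by have := iP t'; rewrite /bump /= add1n t0; case: eqP => _ /=; rewrite ?addn0 ?addn1.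
Qed.

Lemma adm_sum0 rho L : adm_sum 0 rho L = 1.
Proof.
have [m0] : inhabited {ffun 'I_0 -> 'I_n} by split; apply: ffun0; rewrite card_ord.
rewrite /adm_sum (big_pred1 m0) ?big_ord0 // => m.
have -> : m = m0 by apply/ffunP=> -[].
by rewrite /= eqxx; apply/andP; split; apply/forallP=> -[].
Qed.

Lemma adm_sumS s rho L : adm_sum s.+1 rho L =
  \sum_(i < n | (L <= i)%N)
    z (odd (rho 0)) i * adm_sum s (rho \o S) (i + ((rho 0)./2 != (rho 1)./2)).
Proof.
rewrite {1}/adm_sum (reindex (@fcons s)) /=; last exact/onW_bij/fcons_bij.
under [RHS]eq_bigr do rewrite big_distrr /=.
rewrite pair_big_dep /=; apply: eq_big => [[i m]|[i m] _] /=; last first.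
  rewrite big_ord_recl fcons0; congr (_ * _).
  by apply: eq_bigr => r _; rewrite fconsS.
rewrite adm_fcons andbC andbA -andbA; case: (adm _ m); rewrite ?andbF //=.
apply/andP/andP => [[/forallP LP ->]|[Li iP]]; split=> //.
  by have := LP ord0; rewrite fcons0.
apply/forallP=> r; case: (unliftP ord0 r) => [j|] ->; rewrite ?fcons0 ?fconsS //.
by rewrite (leq_trans Li) // (leq_trans _ (forallP iP j)) ?leq_addr.
Qed.

Lemma adm_sum_ge s rho L : (n <= L)%N -> adm_sum s.+1 rho L = 0.
Proof.
move=> le_nL; rewrite adm_sumS big1 // => i le_Li.
by have := leq_trans le_nL le_Li; rewrite leqNgt ltn_ord.
Qed.

(** Either the first index is L or it exceeds L: the recursion of [wordpoly] on a nonempty run. *)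
Lemma adm_sum_rec s rho L (lt_Ln : (L < n)%N) : adm_sum s.+1 rho L =
  z (odd (rho 0)) (Ordinal lt_Ln) *
    adm_sum s (rho \o S) (L + ((rho 0)./2 != (rho 1)./2)) +
  adm_sum s.+1 rho L.+1.
Proof.
rewrite !adm_sumS (bigD1 (Ordinal lt_Ln)) //=; congr (_ + _).
by apply: eq_bigl => i; rewrite [RHS]ltn_neqAle eq_sym andbC.
Qed.

Lemma eq_adm_sum s rho1 rho2 L : rho1 =1 rho2 -> adm_sum s rho1 L = adm_sum s rho2 L.
Proof.
move=> e; apply: eq_big => [m|m _]; last by apply: eq_bigr => r _; rewrite e.
congr (_ && _); apply: eq_forallb => r; apply: eq_forallb => t; by rewrite !e.
Qed.

(** Here [p] is the run of the first position; its parity is the colour at which the list has to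
    start in pair L. The first run is nonempty because [reshape_index] skips empty runs. Induction
    on the number of positions, then on n - L. *)
Lemma adm_sum_wordpoly (zs : seq A) a c p L :
    size zs = n.*2 ->
    (forall i : 'I_n, forall b : bool, nth 0 zs (i.*2 + b) = z b i) ->
    no00 (a.+1 :: c) -> (L <= n)%N ->
  adm_sum (sumn (a.+1 :: c)) (fun r => p + reshape_index (a.+1 :: c) r)%N L =
  wordpoly (a.+1 :: c) (drop (L.*2 + odd p) zs).
Proof.
move=> sz zsE; elim/ltn_ind: {a c}(sumn _) {-2}a {-2}c (erefl (sumn (a.+1 :: c))) p L.
move=> N IH a c def_N p L cP.
move: {2}(n - L)%N (erefl (n - L)%N) => k; elim: k L => [|k IHk] L def_k le_Ln.
  rewrite adm_sum_ge -?subn_eq0 ?def_k // drop_oversize //.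
  by rewrite sz (leq_trans _ (leq_addr _ _)) // leq_double -subn_eq0 def_k.
have lt_Ln : (L < n)%N by rewrite -subn_gt0 def_k.
have lt_sz : (L.*2 + odd p < size zs)%N.
  rewrite sz; case: (odd p); rewrite ?addn0 ?addn1 ?ltn_double ?ltn_Sdouble //.
rewrite (drop_nth 0 lt_sz) wordpoly_consS -[sumn (a.+1 :: c)]/(a + sumn c)%N.+1.
rewrite adm_sum_rec; congr (_ + _); last first.
  rewrite -[(a + sumn c)%N.+1]/(sumn (a.+1 :: c)) IHk ?subnS ?def_k // doubleS !addSn.
  by rewrite -[behead _]drop1 drop_drop add1n.
rewrite reshape_index_cons /= addn0 (zsE (Ordinal lt_Ln)); congr (_ * _).
(* A run of length at least 2 continues at the same variable; a run of length 1 hands over to the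
   next nonempty run. *)
case: a def_N cP {IHk} => [|a] def_N cP; last first.
  rewrite reshape_index_cons /= addn0 eqxx /= addn0.
  rewrite -(zsE (Ordinal lt_Ln)) -(drop_nth 0 lt_sz).
  by rewrite -(IH (sumn (a.+1 :: c))) -?def_N ?(no00_consS _ cP).
have ri1 r : reshape_index (1%N :: c) r.+1 = (reshape_index c r).+1.
  by rewrite reshape_index_cons /= subn1.
rewrite wordpoly_cons0 /= ri1.
have E : adm_sum (sumn c) ((fun r => p + reshape_index (1%N :: c) r)%N \o S) =1
         adm_sum (sumn c) (fun r => p.+1 + reshape_index c r)%N.
  by move=> L'; apply: eq_adm_sum => r /=; rewrite ri1 addnS.
rewrite -[(0 + sumn c)%N]/(sumn c) E.
(* Passing from run p to run p + 1 leaves a block exactly when p is odd. *)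
have LE : (L + (p./2 != p.+1./2) = L + odd p)%N.
  by rewrite -uphalfE uphalf_half; case: (odd p); rewrite ?eqxx // -[X in X != _]add0n eqn_add2r.
case: c def_N cP ri1 E => [|[|b] c] def_N cP ri1 E.
- by rewrite adm_sum0 wordpoly_nil.
(* An empty run follows: unless the word stops there, the next position lies in run p + 2, of the
   same colour and in the next block. *)
- case: c def_N cP ri1 E => [|[|b] c] def_N cP ri1 E //.
    by rewrite adm_sum0 wordpoly_cons0 wordpoly_nil.
  rewrite wordpoly_cons0 -[behead _]drop1 drop_drop add1n.
  rewrite -[sumn (0%N :: _)]/(sumn (b.+1 :: c)).
  rewrite reshape_index_cons /= (reshape_index_cons b.+1) /= !addn2.
  have -> : p./2 != p.+2./2 by rewrite /= neq_ltn ltnSn.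
  have lt_N : (sumn (b.+1 :: c) < N)%N by rewrite -def_N; apply: leqnn.
  have := IH _ lt_N b c erefl p.+2 L.+1 (no00_behead (no00_behead cP)) lt_Ln.
  rewrite [odd _]/= negbK doubleS !addSn addn1 => <-.
  apply: eq_adm_sum => r; rewrite (reshape_index_cons 0%N) /= subn0.
  by rewrite !addSn addnS.
- rewrite reshape_index_cons /= addn1 LE.
  have lt_N : (sumn (b.+1 :: c) < N)%N by rewrite -def_N; apply: leqnn.
  rewrite (IH _ lt_N b c erefl p.+1 (L + odd p)%N (no00_behead cP)).
    congr (wordpoly _ (drop _ _)); rewrite doubleD /=; case: (odd p) => /=.
      by rewrite !addnS !addn0.
    by rewrite !addn0 addn1.
  by case: (odd p); rewrite ?addn1 ?addn0.
Qed.

End AdmissibleSums.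

(** * Deletion of two consecutive variables *)

Section Monomials.
Variable n : nat.
Implicit Types (v w : seq nat) (m : 'X_{1..n.*2}) (p q : Pol n).

Definition zvars : seq (Pol n) := [seq 'X_i | i <- enum 'I_(n.*2)].

(** Short words are padded with zeros, so a prefix also denotes a monomial. *)
Definition mnl v : 'X_{1..n.*2} := [multinom nth 0%N v i | i < n.*2].

Definition zmon (A : comNzRingType) v (s : seq A) : A :=
  \prod_(xa <- zip s v) xa.1 ^+ xa.2.

Lemma size_zvars : size zvars = n.*2.
Proof. by rewrite size_map size_enum_ord. Qed.

Lemma nth_zvars (i : 'I_(n.*2)) : nth 0 zvars i = 'X_i.
Proof. by rewrite (nth_map i) ?size_enum_ord // nth_ord_enum. Qed.

Lemma mnlK v : size v = n.*2 -> mnl v = v :> seq nat.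
Proof.
move=> sz; apply: (@eq_from_nth _ 0%N) => [|i]; rewrite size_tuple ?sz // => lt_i.
by rewrite -(mnm_nth _ _ (Ordinal lt_i)) mnmE.
Qed.

Lemma mnl_val m : mnl m = m.
Proof. by apply/mnmP=> i; rewrite mnmE -mnm_nth. Qed.

Lemma size_mnm m : size m = n.*2.
Proof. exact: size_tuple. Qed.

Lemma mpolyX_zmon m : 'X_[m] = zmon m zvars.
Proof.
rewrite -[val (val m)]map_tnth_enum /zmon /zvars zip_map big_map mpolyXE_id big_enum.
by apply: eq_bigr.
Qed.

Lemma mpolyX_mnl v : size v = n.*2 -> 'X_[mnl v] = zmon v zvars.
Proof. by move=> sz; rewrite mpolyX_zmon mnlK. Qed.

Lemma zmon_cat (A : comNzRingType) v w (s t : seq A) : size v = size s ->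
  zmon (v ++ w) (s ++ t) = zmon v s * zmon w t.
Proof. by move=> sz; rewrite /zmon zip_cat // big_cat. Qed.

Lemma zmon_cons (A : comNzRingType) a v x (s : seq A) :
  zmon (a :: v) (x :: s) = x ^+ a * zmon v s.
Proof. by rewrite /zmon big_cons. Qed.

Lemma zmon_map (A B : comNzRingType) (f : {rmorphism A -> B}) v (s : seq A) :
  zmon v (map f s) = f (zmon v s).
Proof.
elim: s v => [|x s IH] [|a v] /=; rewrite ?zmon_cons ?rmorphM ?rmorphXn ?IH //;
  by rewrite /zmon !big_nil rmorph1.
Qed.

Lemma Fbq_wordpoly c : bicomposition c -> Fbq n c = wordpoly c zvars.
Proof.
move=> /andP[cev cP]; rewrite /Fbq; case: leqP => [_|n_lt]; last first.
  rewrite wordpoly_small // size_zvars addn1.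
  by rewrite -[size c]odd_double_half (negbTE cev) add0n ltn_Sdouble.
pose z b (i : 'I_n) : Pol n := if b then 'X_(yvar i) else 'X_(xvar i).
have zE (i : 'I_n) (b : bool) : nth 0 zvars (i.*2 + b) = z b i.
  case: b; rewrite ?addn1 ?addn0 /z.
    by rewrite -(nth_zvars (yvar i)).
  by rewrite -(nth_zvars (xvar i)).
transitivity (adm_sum z (sumn c) (reshape_index c) 0).
  apply: eq_bigl => m; rewrite andbC.
  by have -> : [forall r, (0 <= m r)%N] by apply/forallP.
case: c cev cP => [|[|a] c] cev cP; first by rewrite adm_sum0 wordpoly_nil.
- case: c cev cP => [|[|b] c] // cev cP.
  rewrite wordpoly_cons0 -[sumn (0%N :: _)]/(sumn (b.+1 :: c)).
  (* The first run is empty, so position 0 lies in run 1 and the list starts at y_1. *)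
  rewrite -drop1 -(adm_sum_wordpoly 1 (L := 0) size_zvars zE) //.
- have := adm_sum_wordpoly 0 (L := 0) size_zvars zE cP (leq0n _).
  rewrite drop0 => <-; exact: eq_adm_sum.
Qed.

End Monomials.

Arguments zvars : clear implicits.

Section Deletion.
Variable n : nat.

(* Substitution z_i = z_(i+1) = 0, followed by the shift z_(j+2) := z_j. *)
Definition delvars (i : nat) : (n.+1.*2).-tuple (Pol n) :=
  [tuple nth 0 (take i (zvars n) ++ [:: 0, 0 & drop i (zvars n)]) j | j < n.+1.*2].

End Deletion.

Notation Rdel i := (comp_mpoly (delvars _ i)).

Section DeletionTheory.
Variable n : nat.
Implicit Types (v w : seq nat) (p q : Pol n.+1).

Lemma Rdel_zvars i : (i <= n.*2)%N ->
  map (Rdel i) (zvars n.+1) = take i (zvars n) ++ [:: 0, 0 & drop i (zvars n)].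
Proof.
move=> le_i; set t := take i _ ++ _.
have sz : size t = n.+1.*2.
  by rewrite size_cat /= !addnS -size_cat cat_take_drop size_zvars doubleS.
rewrite -map_comp (@eq_map _ _ _ (fun j : 'I__ => nth 0 t j)) => [|j].
  by rewrite (map_comp (nth 0 t) val) val_enum_ord -sz map_nth_iota0 ?take_size.
by rewrite /= comp_mpolyXU -tnth_nth tnth_mktuple.
Qed.

(** The variables become the shorter list with two adjacent zeros inserted, which [wordpoly_del00]
    ignores; hence the same result for every i. *)
Lemma Rdel_wordpoly i c : (i <= n.*2)%N -> no00 c ->
  Rdel i (wordpoly c (zvars n.+1)) = wordpoly c (zvars n).
Proof.
by move=> le_i cP; rewrite -wordpoly_map Rdel_zvars // wordpoly_del00 // cat_take_drop.
Qed.

Lemma Rdel_mpolyX i v w a b : size v = i -> size (v ++ [:: a, b & w]) = n.+1.*2 ->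
  Rdel i 'X_[mnl n.+1 (v ++ [:: a, b & w])] =
    if (a == 0%N) && (b == 0%N) then 'X_[mnl n (v ++ w)] else 0 :> Pol n.
Proof.
move=> szv sz; have le_i : (i <= n.*2)%N.
  by move: sz; rewrite size_cat szv /= !addnS doubleS => -[<-]; rewrite leq_addr.
have sz_vw : size (v ++ w) = n.*2.
  by move: sz; rewrite !size_cat /= !addnS doubleS => -[].
rewrite mpolyX_mnl // -zmon_map Rdel_zvars // zmon_cat ?size_takel ?size_zvars //.
rewrite !zmon_cons !expr0n; case: eqP => _ /=; last by rewrite mul0r mulr0.
case: eqP => _ /=; last by rewrite mul0r mul1r mulr0.
rewrite !mul1r -zmon_cat ?size_takel ?size_zvars // cat_take_drop.
by rewrite mpolyX_mnl.
Qed.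

Lemma mnm_split2 i (m : 'X_{1..n.+1.*2}) : (i <= n.*2)%N ->
  exists v a b w, [/\ size v = i, size (v ++ w) = n.*2,
    size (v ++ [:: a, b & w]) = n.+1.*2 & m = mnl n.+1 (v ++ [:: a, b & w])].
Proof.
move=> le_i; have sz := size_mnm m.
have lt1 : (i.+1 < size m)%N by rewrite sz doubleS !ltnS.
have e : take i m ++ [:: nth 0%N m i, nth 0%N m i.+1 & drop i.+2 m] = m.
  by rewrite -(drop_nth 0%N lt1) -(drop_nth 0%N (ltnW lt1)) cat_take_drop.
exists (take i m), (nth 0%N m i), (nth 0%N m i.+1), (drop i.+2 m).
rewrite e mnl_val size_takel ?sz 1?ltnW 1?ltnW // -?sz //; split=> //.
by move: sz; rewrite -[in LHS]e !size_cat /= !addnS => -[].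
Qed.

(** Only monomials without the two deleted variables survive, and erasing their two zero exponents
    is injective. *)
Lemma mcoeff_Rdel i v w p : size v = i -> size (v ++ w) = n.*2 ->
  (Rdel i p)@_(mnl n (v ++ w)) = p@_(mnl n.+1 (v ++ [:: 0%N, 0%N & w])).
Proof.
move=> szv sz; elim/mpolyind: p => [|c m p _ _ IH].
  by rewrite comp_mpoly0 !mcoeff0.
rewrite comp_mpolyD comp_mpolyZ !mcoeffD !mcoeffZ IH; congr (_ * _ + _).
have le_i : (i <= n.*2)%N by rewrite -sz size_cat szv leq_addr.
have [v' [a [b [w' [szv' sz1 sz2 ->]]]]] := mnm_split2 m le_i.
rewrite Rdel_mpolyX // mcoeffX.
have -> : (mnl n.+1 (v' ++ [:: a, b & w']) == mnl n.+1 (v ++ [:: 0, 0 & w])%N) =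
          [&& a == 0, b == 0 & v' ++ w' == v ++ w]%N.
  rewrite -val_eqE -(inj_eq val_inj) /= !mnlK //; last first.
    by rewrite size_cat /= !addnS -size_cat sz doubleS.
  rewrite !eqseq_cat ?szv ?szv' // !eqseq_cons.
  by case: (v' == v); case: (a == 0%N); case: (b == 0%N).
case: eqP => _ /=; last by rewrite mcoeff0.
case: eqP => _ /=; last by rewrite mcoeff0.
rewrite mcoeffX; congr (_%:R); congr (nat_of_bool _).
by rewrite -val_eqE -(inj_eq val_inj) /= !mnlK.
Qed.

End DeletionTheory.

(** * Divided differences and linear independence *)

Section Support.
Variables (N : nat) (P : pred 'X_{1..N}).
Implicit Types p q : {mpoly rat[N]}.

Definition supp_in p : bool := all P (msupp p).

Lemma supp_inP p : reflect (forall m, p@_m != 0 -> P m) (supp_in p).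
Proof.
by apply: (iffP allP) => pP m; [rewrite -mcoeff_msupp | rewrite mcoeff_msupp]; apply: pP.
Qed.

Lemma supp_in0 : supp_in 0.
Proof. by apply/supp_inP=> m; rewrite mcoeff0 eqxx. Qed.

Lemma supp_inD p q : supp_in p -> supp_in q -> supp_in (p + q).
Proof.
move=> /supp_inP pP /supp_inP qP; apply/supp_inP=> m; rewrite mcoeffD.
by have [/eqP->|/pP //] := boolP (p@_m == 0); rewrite add0r => /qP.
Qed.

Lemma supp_inN p : supp_in (- p) = supp_in p.
Proof. by apply/supp_inP/supp_inP=> pP m pm; apply: pP; move: pm; rewrite mcoeffN oppr_eq0. Qed.

Lemma supp_inB p q : supp_in p -> supp_in q -> supp_in (p - q).
Proof. by rewrite -(supp_inN q); apply: supp_inD. Qed.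

Lemma supp_inZ a p : supp_in p -> supp_in (a *: p).
Proof.
by move=> /supp_inP pP; apply/supp_inP=> m; rewrite mcoeffZ mulf_eq0 negb_or => /andP[_ /pP].
Qed.

Lemma supp_inX m : supp_in 'X_[m] = P m.
Proof. by rewrite /supp_in msuppX /= andbT. Qed.

Lemma supp_in_sum (I : Type) (r : seq I) (Q : pred I) (F : I -> {mpoly rat[N]}) :
  (forall i, Q i -> supp_in (F i)) -> supp_in (\sum_(i <- r | Q i) F i).
Proof. by move=> FP; elim/big_ind: _ => // *; [apply: supp_in0 | apply: supp_inD]. Qed.

End Support.

(** * 2-Dyck words and the effect of divided differences on them *)

Section Dyck.
Variable n : nat.

Definition dyck (v : seq nat) : bool :=
  [forall l : 'I_n, (sumn (take l.+1.*2 v) <= l)%N].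

Lemma sum_take (v : seq nat) k N : size v = N ->
  (\sum_(i < N | (i < k)%N) nth 0%N v i = sumn (take k v))%N.
Proof.
move=> <-{N}; elim: v k => [|a v IH] [|k] /=.
- by rewrite big_ord0.
- by rewrite big_ord0.
- by rewrite big_pred0.
- by rewrite big_mkcond big_ord_recl /= -big_mkcond /= -IH.
Qed.

Lemma two_dyckE (m : 'X_{1..n.*2}) : two_dyck m = dyck m.
Proof.
apply: eq_forallb => l; rewrite -(sum_take _ (size_mnm m)).
by congr (_ <= _)%N; apply: eq_bigr => i _; rewrite -mnm_nth.
Qed.

Lemma two_dyck_mnl v : size v = n.*2 -> two_dyck (mnl n v) = dyck v.
Proof. by move=> sz; rewrite two_dyckE mnlK. Qed.

End Dyck.

(** Losing two letters lowers the bound on later prefixes by one, and the strict drop of the letter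
    sum makes up for it. *)
Lemma dyck_trim n v w a b c x : dyck n.+1 (v ++ [:: a, b, c & w]) ->
  (x < a + b + c)%N -> dyck n (v ++ x :: w).
Proof.
move=> /forallP vP lt_x; apply/forallP=> l; have [le_l|lt_l] := leqP l.+1.*2 (size v).
  have := vP (widen_ord (leqnSn n) l).
  by rewrite !takel_cat.
have := vP (lift ord0 l); rewrite /= /bump /= add1n => le_l.
rewrite -ltnS; apply: leq_trans le_l.
move: (subnKC lt_l); set k := (_ - _)%N => kE.
rewrite (doubleS l.+1) -kE !take_cat.
have F j : (size v + j < size v)%N = false by rewrite ltnNge leq_addr.
have -> : ((size v).+1 + k = size v + k.+1)%N by rewrite addSnnS.
have -> : ((size v + k.+1).+2 = size v + k.+3)%N by rewrite !addnS.
rewrite !F !addKn.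
by rewrite !sumn_cat /= ltn_add2l !addnA ltn_add2r.
Qed.

Lemma mpolyX_mnlS n v w x : size (v ++ x.+1 :: w) = n.*2 ->
  'X_[mnl n (v ++ x.+1 :: w)] =
    nth 0 (zvars n) (size v) * 'X_[mnl n (v ++ x :: w)] :> Pol n.
Proof.
move=> sz; have sz' : size (v ++ x :: w) = n.*2 by rewrite -sz !size_cat.
have lt_v : (size v < size (zvars n))%N.
  by rewrite size_zvars -sz size_cat /= addnS ltnS leq_addr.
rewrite !mpolyX_mnl // -{1 3}(cat_take_drop (size v) (zvars n)).
rewrite (drop_nth 0 lt_v) !zmon_cat ?size_takel // 1?ltnW //.
by rewrite !zmon_cons exprS -mulrA mulrCA.
Qed.

Section Trimming.
Variables (n i : nat).
Hypothesis lt_i : (i < n.*2)%N.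

(** Let a, b, c be the letters at i, i + 1, i + 2. Deletion at i needs a = b = 0 and keeps c;
    deletion at i + 1 needs b = c = 0 and keeps a. The difference is nonzero only if b = 0 and
    exactly one of a, c is positive; lowering that letter by one gives q up to sign. *)
Lemma trim_mpolyX (m : 'X_{1..n.+1.*2}) : exists q : Pol n,
  Rdel i.+1 'X_[m] - Rdel i 'X_[m] = nth 0 (zvars n) i * q
  /\ (two_dyck m -> supp_in (@two_dyck n) q).
Proof.
have [va [b [c [w [szv sz1 sz2 ->]]]]] := mnm_split2 m lt_i.
case/lastP: va szv sz1 sz2 => [//|v a]; rewrite size_rcons => -[szv].
rewrite !cat_rcons => sz1 sz2; rewrite -[in Rdel i.+1 _]cat_rcons.
rewrite Rdel_mpolyX ?size_rcons ?szv ?cat_rcons // Rdel_mpolyX //.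
rewrite two_dyck_mnl //.
have sz3 x : size (v ++ x :: w) = n.*2 by rewrite -sz1 !size_cat.
have dyckP x : (x < a + b + c)%N -> dyck n.+1 (v ++ [:: a, b, c & w]) ->
    supp_in (@two_dyck n) ('X_[mnl n (v ++ x :: w)]).
  by move=> lt_x vP; rewrite supp_inX two_dyck_mnl // (dyck_trim vP).
move: dyckP; case: eqP => [->|_] dyckP /=; last first.
  by exists 0; rewrite andbF mulr0 subr0; split=> // _; apply: supp_in0.
rewrite andbT; case: a c dyckP {sz1 sz2} => [|a] [|c] dyckP /=.
- by exists 0; rewrite mulr0 subrr; split=> // _; apply: supp_in0.
- exists (- 'X_[mnl n (v ++ c :: w)]); rewrite mpolyX_mnlS // szv sub0r mulrN.
  by split=> // vP; rewrite supp_inN dyckP.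
- exists 'X_[mnl n (v ++ a :: w)]; rewrite mpolyX_mnlS // szv subr0.
  by split=> // vP; rewrite dyckP // !addn0.
- by exists 0; rewrite mulr0 subrr; split=> // _; apply: supp_in0.
Qed.

Lemma trim (p : Pol n.+1) : exists q : Pol n,
  Rdel i.+1 p - Rdel i p = nth 0 (zvars n) i * q
  /\ (supp_in (@two_dyck n.+1) p -> supp_in (@two_dyck n) q).
Proof.
suff [q []] : exists q : Pol n,
    Rdel i.+1 (\sum_(m <- msupp p) p@_m *: 'X_[m]) -
    Rdel i (\sum_(m <- msupp p) p@_m *: 'X_[m]) = nth 0 (zvars n) i * q
    /\ (all (@two_dyck n.+1) (msupp p) -> supp_in (@two_dyck n) q).
  by rewrite -mpolyE => qE qP; exists q.
elim: (msupp p) => [|m s [q [qE qP]]].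
  by exists 0; rewrite big_nil !comp_mpoly0 subrr mulr0; split=> // _; apply: supp_in0.
have [q1 [q1E q1P]] := trim_mpolyX m; exists (p@_m *: q1 + q).
rewrite big_cons !comp_mpolyD opprD addrACA qE mulrDr !comp_mpolyZ -scalerBr q1E.
rewrite scalerAr; split=> // /= /andP[mP sP].
by rewrite supp_inD ?supp_inZ ?q1P ?qP.
Qed.

End Trimming.

(** * Deletion on the ideal, and linear independence *)

Section Ideal.

Lemma mcoeff_Rdel0 n i (p : Pol n.+1) : (i <= n.*2)%N -> (Rdel i p)@_0%MM = p@_0%MM.
Proof.
move=> le_i; have E k : 0%MM = mnl k (nseq k.*2 0%N).
  by apply/mnmP=> j; rewrite mnm0E mnmE nth_nseq if_same.
have e : nseq n.*2 0%N = nseq i 0%N ++ nseq (n.*2 - i) 0%N by rewrite -nseqD subnKC.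
rewrite (E n) (E n.+1) e mcoeff_Rdel ?size_nseq -?e ?size_nseq //.
rewrite -[[:: 0%N, 0%N & _]]/(nseq (n.*2 - i).+2 0%N) -nseqD.
by rewrite !addnS subnKC // doubleS.
Qed.

Lemma Fbq_Rdel n i c : (i <= n.*2)%N -> bicomposition c ->
  Rdel i (Fbq n.+1 c) = Fbq n c.
Proof.
by move=> le_i cP; rewrite !Fbq_wordpoly // Rdel_wordpoly //; case/andP: cP.
Qed.

(** One [h] serves all i at once, so every divided difference of [g] vanishes. *)
Lemma bqsym_Rdel n (g : Pol n.+1) : bqsym g ->
  exists2 h, bqsym h & forall i, (i <= n.*2)%N -> Rdel i g = h.
Proof.
move=> [m [a [f [fP ->]]]].
exists (\sum_(j < m) a j *: Rdel 0 (f j)).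
  exists m, a, (fun j => Rdel 0 (f j)); split=> // j.
  by have [c cP ->] := fP j; exists c => //; rewrite Fbq_Rdel.
move=> i le_i; rewrite raddf_sum; apply: eq_bigr => j _.
by have [c cP ->] := fP j; rewrite /= comp_mpolyZ !Fbq_Rdel.
Qed.

Lemma bqsym0_Rdel n (g : Pol n.+1) : bqsym0 g ->
  exists2 h, bqsym0 h & forall i, (i <= n.*2)%N -> Rdel i g = h.
Proof.
move=> [/bqsym_Rdel[h hP gE] g0]; exists h => //; split=> //.
by rewrite -(gE 0%N) // mcoeff_Rdel0.
Qed.

Lemma bqideal_mcoeff0 n (p : Pol n) : p \in @bqideal n -> p@_0%MM = 0.
Proof.
move=> /asboolP[m [a [g [gP ->]]]]; rewrite raddf_sum big1 //= => i _.
have [_ g0] := gP i.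
by apply: etrans ((mcoeff0_is_multiplicative _ _).1 (a i) (g i)) _; rewrite g0 mulr0.
Qed.

(* In p = sum_j a_j g_j only the coefficients a_j get trimmed, because every
   divided difference of g_j vanishes. *)
Lemma trim_ideal n i (p : Pol n.+1) : (i < n.*2)%N -> p \in @bqideal n.+1 ->
  exists2 q : Pol n, q \in @bqideal n &
    Rdel i.+1 p - Rdel i p = nth 0 (zvars n) i * q.
Proof.
move=> lt_i /asboolP[m [a [g [gP ->]]]].
have [q qE] := choice (fun j => trim lt_i (a j)).
have gR j : exists h, bqsym0 h /\ forall i, (i <= n.*2)%N -> Rdel i (g j) = h.
  by have [h h1 h2] := bqsym0_Rdel (gP j); exists h.
have [h hP] := choice gR.
exists (\sum_(j < m) q j * h j).
  by apply/asboolP; exists m, q, h; split=> // j; case: (hP j).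
rewrite (raddf_sum (Rdel i.+1)) (raddf_sum (Rdel i)) -sumrB mulr_sumr; apply: eq_bigr => j _ /=.
have [_ gE] := hP j; rewrite !rmorphM /= !gE // 1?ltnW // -mulrBl.
by have [-> _] := qE j; rewrite mulrA.
Qed.

Lemma first_letter (v : seq nat) :
  v = nseq (size v) 0%N \/ exists j a w, v = nseq j 0%N ++ a.+1 :: w.
Proof.
elim: v => [|[|a] v [IH|[j [b [w ->]]]]]; first by left.
- by left; rewrite /= -IH.
- by right; exists j.+1, b, w.
- by right; exists 0%N, a, v.
- by right; exists 0%N, a, (nseq j 0%N ++ b.+1 :: w).
Qed.

Lemma Rdel_invariant_const n (p : Pol n.+1) :
    (forall i, (i < n.*2)%N -> Rdel i.+1 p = Rdel i p) ->
    supp_in (@two_dyck n.+1) p ->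
  p = (p@_0%MM)%:MP.
Proof.
move=> pR /supp_inP pP.
have p0 j a w : size (nseq j 0%N ++ a.+1 :: w) = n.+1.*2 ->
    p@_(mnl n.+1 (nseq j 0%N ++ a.+1 :: w)) = 0.
  elim/ltn_ind: j w => -[|[|j]] IH w sz.
  (* A positive letter in the first pair violates the first 2-Dyck inequality. *)
  - apply/eqP; apply: contraT => /pP; rewrite two_dyck_mnl // => /forallP/(_ ord0).
    by rewrite -[ord0.+1.*2]/2%N; case: (w).
  - apply/eqP; apply: contraT => /pP; rewrite two_dyck_mnl // => /forallP/(_ ord0).
    by rewrite -[ord0.+1.*2]/2%N.
  have nseqS2 : nseq j.+2 0%N ++ a.+1 :: w = nseq j 0%N ++ [:: 0%N, 0%N, a.+1 & w].
    by rewrite -addn2 nseqD -catA.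
  have sz' : size (nseq j 0%N ++ a.+1 :: w) = n.*2.
    by move: sz; rewrite !size_cat !size_nseq doubleS /= => -[->].
  have lt_j : (j < n.*2)%N by rewrite -sz' size_cat size_nseq /= addnS ltnS leq_addr.
  (* The same coefficient is read in [Rdel j p] and in [Rdel j.+1 p]: back in p, the first has the
     pair 00 before the letter a + 1, the second after it. *)
  rewrite nseqS2 -(mcoeff_Rdel (i := j)) ?size_nseq // -pR // -cat_rcons.
  rewrite mcoeff_Rdel ?size_rcons ?size_nseq ?cat_rcons //.
  by rewrite IH // size_cat size_nseq /= !addnS doubleS -sz' size_cat size_nseq /= addnS.
apply/mpolyP=> m; rewrite mcoeffC; have [->|m0] := eqVneq m 0%MM; first by rewrite mulr1.
rewrite mulr0; have [mE|[j [a [w mE]]]] := first_letter m.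
  case/eqP: m0; apply/mnmP=> k; rewrite (mnm_nth 0%N) mE nth_nseq mnm0E.
  by rewrite if_same.
by rewrite -[m]mnl_val mE p0 // -mE size_tuple.
Qed.

Theorem dyck_ideal0 n (p : Pol n) :
  p \in @bqideal n -> supp_in (@two_dyck n) p -> p = 0.
Proof.
elim: n p => [|n IH] p pI pP.
  by rewrite (nvar0_mpolyC_eq p erefl) bqideal_mcoeff0.
rewrite (@Rdel_invariant_const n p) ?bqideal_mcoeff0 ?mpolyC0 // => i lt_i.
have [q qI qE] := trim_ideal lt_i pI; have [q' [q'E /(_ pP) q'P]] := trim lt_i p.
apply/eqP; rewrite -subr_eq0 qE; apply/eqP.
have zi : nth 0 (zvars n) i != 0.
  rewrite (nth_zvars (Ordinal lt_i)); apply/eqP=> /(congr1 (mcoeff U_(Ordinal lt_i))).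
  by rewrite mcoeffX eqxx mcoeff0 => /eqP; rewrite oner_eq0.
(* Cancelling the variable identifies the quotient that lies in the ideal with the one that has
   2-Dyck support, so the induction hypothesis applies. *)
have qq' : q = q' by apply: (mulfI zi); rewrite -qE.
by rewrite (IH q) ?mulr0 // qq'.
Qed.

End Ideal.

(** * Spanning *)

Section Lex.

(** False when one word is a prefix of the other: a comparison is decided at a common position,
    hence survives appending anything. *)
Fixpoint lexlt (u v : seq nat) : bool :=
  match u, v with
  | x :: u', y :: v' => (x < y)%N || (x == y) && lexlt u' v'
  | _, _ => false
  end.

Lemma lexlt_cat u v s t : lexlt u v -> lexlt (u ++ s) (v ++ t).
Proof.
by elim: u v => [|x u IH] [|y v] //= /orP[->//|/andP[-> /IH ->]]; rewrite orbT.
Qed.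

Lemma lexlt_rcons u x y : lexlt (rcons u x) (rcons u y) = (x < y)%N.
Proof. by elim: u => [|a u IH] /=; rewrite ?andbF ?orbF // ltnn eqxx. Qed.

Lemma lexlt_rcons0 u v x : size u = size v ->
  lexlt (rcons u x) (rcons v 0%N) -> lexlt u v.
Proof.
elim: u v => [|a u IH] [|b v] //=; first by rewrite andbF.
by move=> [/IH uv] /orP[->//|/andP[-> /uv ->]]; rewrite orbT.
Qed.

(** Infinitely many words may lie below [v], since letters are unbounded; the induction runs on the
    length, then on the first letter. *)
Lemma lexlt_ind k (P : seq nat -> Prop) :
    (forall v, size v = k -> (forall u, size u = k -> lexlt u v -> P u) -> P v) ->
  forall v, size v = k -> P v.
Proof.
elim: k P => [|k IH] P Pind.
  by move=> v sz; apply: Pind => // u; case: u.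
suff Px x : forall v, size v = k -> P (x :: v) by case=> // x v [/Px].
elim/ltn_ind: x => x IHx; apply: IH => v sz IHv.
apply: Pind => [|[|y u] //= [szu]]; first by rewrite /= sz.
by case/orP=> [lt_yx|/andP[/eqP-> lt_uv]]; [apply: IHx | apply: IHv].
Qed.

End Lex.

Lemma no00_consF b c : no00 c -> no00 (b :: c) = false ->
  b = 0%N /\ exists d, c = 0%N :: d.
Proof.
by case: b c => [|b] [|[|a] c] //= cP; rewrite ?cP //; split=> //; exists c.
Qed.

Lemma sumn_take_le k v w : (sumn (take k v) <= sumn (take k (v ++ w)))%N.
Proof.
rewrite take_cat; case: ltnP => // le_v.
by rewrite (take_oversize le_v) sumn_cat leq_addr.
Qed.

Lemma dyck_rcons0 n v : dyck n (rcons v 0%N) = dyck n v.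
Proof.
apply: eq_forallb => l; congr (_ <= _)%N; rewrite -cats1 take_cat.
case: ltnP => // le_v; rewrite (take_oversize le_v) sumn_cat.
by case: (_ - _)%N => [|[|k]]; rewrite addn0.
Qed.

(** Counterpart of [dyck_trim]: later prefixes lose at most one unit of sum while their bound drops
    by one, so a violation persists. Used with b = a + 1 and b = a. *)
Lemma not_dyck_del00 n w a b c : (a <= b)%N ->
  ~~ dyck n (w ++ [:: 0%N, 0%N, a.+1 & c]) -> ~~ dyck n (w ++ b :: c).
Proof.
move=> le_ab; rewrite !negb_forall => /existsP[l]; rewrite -ltnNge => lt_l; apply/existsP.
have [le_l|lt_w] := leqP l.+1.*2 (size w).+2.
  exists l; rewrite -ltnNge; apply: leq_trans (sumn_take_le _ _ _).
  apply: leq_trans lt_l _; rewrite take_cat.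
  case: ltnP => // le_w; rewrite (take_oversize le_w).
  rewrite sumn_cat.
  have : (l.+1.*2 - size w <= 2)%N by rewrite leq_subLR addn2.
  by case: (_ - _)%N => [|[|[|k]]]; rewrite /= ?addn0.
(* The violating prefix extends past the two zeros and becomes the prefix of index l - 1 in the
   shorter word. *)
have l_gt0 : (0 < l)%N by case: (l : nat) lt_w => // -[].
have lt_l' : (l.-1 < n)%N := leq_ltn_trans (leq_pred _) (ltn_ord l).
exists (Ordinal lt_l'); rewrite -ltnNge /= prednK // -(leq_add2r 1) addn1.
move: lt_w; rewrite doubleS !ltnS => lt_w.
move: (subnKC lt_w); set k := (_ - _)%N => kE.
apply: leq_trans lt_l _; rewrite doubleS -kE !take_cat.
have F j : (size w + j < size w)%N = false by rewrite ltnNge leq_addr.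
have -> : ((size w).+1 + k = size w + k.+1)%N by rewrite addSnnS.
have -> : ((size w + k.+1).+2 = size w + k.+3)%N by rewrite !addnS.
by rewrite !F !addKn /= !sumn_cat /= addn1 !add0n addSn addnS ltnS leq_add2l leq_add2r.
Qed.

Section SupportMul.
Variable N : nat.
Implicit Types p q : {mpoly rat[N]}.

Lemma supp_inM (P1 P2 P : pred 'X_{1..N}) p q :
    (forall m1 m2, P1 m1 -> P2 m2 -> P (m1 + m2)%MM) ->
  supp_in P1 p -> supp_in P2 q -> supp_in P (p * q).
Proof.
move=> PD /allP pP /allP qP; apply/allP=> m /msuppM_le /allpairsP[[m1 m2]] /=.
by case=> /pP m1P /qP m2P ->; apply: PD.
Qed.

Lemma supp_inXM (P Q : pred 'X_{1..N}) m0 p :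
    (forall m, P m -> Q (m0 + m)%MM) -> supp_in P p -> supp_in Q ('X_[m0] * p).
Proof.
move=> PQ; apply: (@supp_inM (pred1 m0)); first by move=> _ m /eqP-> /PQ.
by rewrite supp_inX /=.
Qed.

Lemma supp_in_sub (P Q : pred 'X_{1..N}) p : subpred P Q -> supp_in P p -> supp_in Q p.
Proof. by move=> PQ; rewrite /supp_in; apply: sub_all. Qed.

End SupportMul.

(** * Reduction of words that are not 2-Dyck *)

Section Spanning.
Variable n : nat.
Implicit Types (v w c : seq nat) (m : 'X_{1..n.*2}) (p q : Pol n).

Local Notation I := (@bqideal n).
Local Notation zs := (zvars n).

Lemma Fbq_mcoeff0 c : (0 < sumn c)%N -> (Fbq n c)@_0%MM = 0.
Proof.
move=> c_gt0; rewrite /Fbq; case: leqP => [_|_]; last exact: mcoeff0.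
rewrite raddf_sum big1 //= => f _; rewrite (bigD1 (Ordinal c_gt0)) //=.
apply: etrans ((mcoeff0_is_multiplicative _ _).1 _ _) _; rewrite [X in X * _](_ : _ = 0) ?mul0r //.
by rewrite /zvar; case: ifP => _; rewrite mcoeffX mnm1_eq0.
Qed.

(** A word of odd length loses a final 0 or gains one, which turns it into a bicomposition without
    changing [wordpoly]. *)
Lemma wordpoly_ideal c : no00 c -> (0 < sumn c)%N -> wordpoly c zs \in I.
Proof.
move=> cP c_gt0.
have FI d : bicomposition d -> (0 < sumn d)%N -> wordpoly d zs \in I.
  move=> dP d_gt0; rewrite -Fbq_wordpoly //; apply/asboolP.
  exists 1%N, (fun=> 1), (fun=> Fbq n d); rewrite big_ord1 mul1r; split=> // _.
  split; last exact: Fbq_mcoeff0.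
  exists 1%N, (fun=> 1), (fun=> Fbq n d); rewrite big_ord1 scale1r; split=> // _.
  by exists d.
case cev: (odd (size c)); last by rewrite FI // /bicomposition /bivector cev.
case/lastP: c => [|c a] // in cP c_gt0 cev *.
case: a => [|a] in cP c_gt0 cev *.
  rewrite wordpoly_rcons0 FI //; last by rewrite sumn_rcons addn0 in c_gt0.
  rewrite size_rcons /= in cev.
  rewrite /bicomposition /bivector cev.
  by move: cP; rewrite /no00 -cats1 => /cat_sorted2[->].
rewrite -wordpoly_rcons0 FI ?sumn_rcons ?addn0 // -?sumn_rcons //.
rewrite /bicomposition /bivector size_rcons /= cev /=.
by case: c {cev c_gt0} cP => //= b c cP; rewrite rcons_path cP last_rcons.
Qed.

Lemma nth_mnmD m1 m2 i :
  nth 0%N (m1 + m2)%MM i = (nth 0%N m1 i + nth 0%N m2 i)%N.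
Proof.
have [lt_i|le_i] := ltnP i n.*2; last by rewrite !nth_default ?size_tuple.
by have := mnmDE (Ordinal lt_i) m1 m2; rewrite !(mnm_nth 0%N).
Qed.

(** Multiplying by such a monomial preserves the first k exponents, all that [low] sees for a prefix
    of length k. *)
Definition free k m : bool := all (pred1 0%N) (take k m).

Lemma freeP k m : reflect (forall i, (i < k)%N -> nth 0%N m i = 0%N) (free k m).
Proof.
apply: (iffP (all_nthP 0%N)) => mP i => [lt_ik|].
  have [lt_in|le_n] := ltnP i (size m); last by rewrite nth_default.
  by have := mP i; rewrite size_take_min leq_min lt_ik lt_in nth_take // => /(_ isT) /eqP.
by rewrite size_take_min leq_min => /andP[lt_ik _]; rewrite nth_take //= mP.
Qed.

Lemma take_mnmD k m1 m2 : free k m1 -> take k (m1 + m2)%MM = take k m2.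
Proof.
move=> /freeP m1P; apply: (@eq_from_nth _ 0%N) => [|i].
  by rewrite !size_take !size_tuple.
rewrite size_take_min leq_min => /andP[lt_ik _].
by rewrite !nth_take // nth_mnmD m1P.
Qed.

Lemma freeD k m1 m2 : free k m1 -> free k m2 -> free k (m1 + m2)%MM.
Proof. by rewrite {2 3}/free => m1P; rewrite take_mnmD. Qed.

Lemma nth_mnmU (i : 'I_(n.*2)) j : nth 0%N U_(i)%MM j = (i == j :> nat).
Proof.
have [lt_j|le_j] := ltnP j n.*2; first by rewrite -(mnm_nth _ _ (Ordinal lt_j)) mnm1E.
by rewrite nth_default ?size_tuple // ltn_eqF // (leq_trans _ le_j).
Qed.

Lemma freeU k (i : 'I_(n.*2)) : (k <= i)%N -> free k U_(i)%MM.
Proof.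
move=> le_k; apply/freeP => j lt_j.
by rewrite nth_mnmU gtn_eqF // (leq_trans lt_j).
Qed.

Lemma free0 k : free k 0%MM.
Proof.
apply/freeP => j _; have [lt_j|le_j] := ltnP j n.*2.
  by rewrite -(mnm_nth _ _ (Ordinal lt_j)) mnm0E.
by rewrite nth_default ?size_tuple.
Qed.

Lemma free_wordpoly k c : supp_in (free k) (wordpoly c (drop k zs)).
Proof.
suff F s : all (supp_in (free k)) s -> supp_in (free k) (wordpoly c s).
  apply: F; apply/(all_nthP 0) => i; rewrite size_drop size_zvars => lt_i.
  have lt_ki : (k + i < n.*2)%N by rewrite -ltn_subRL.
  by rewrite nth_drop (nth_zvars (Ordinal lt_ki)) supp_inX freeU //= leq_addr.
have F1 : supp_in (free k) (1 : Pol n) by rewrite -mpolyX0 supp_inX free0.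
elim/ltn_ind: {s}(size s) {-2}s (erefl (size s)) c => d IH [_|x s sz] c sP.
  by rewrite wordpoly_nilr; case: eqP => _ //; apply: supp_in0.
case: c => [|a c]; first by rewrite wordpoly_nil.
have [xP s'P] := andP sP; elim: a => [|a IHa].
  by rewrite wordpoly_cons0; apply: (IH (size s)) => //; rewrite -sz.
rewrite wordpoly_consS supp_inD //.
  by apply: supp_inM IHa; [apply: freeD | ].
apply: (IH (size (behead s))) => //; first by rewrite -sz size_behead ltnS leq_pred.
by case: (s) s'P => //= y t /andP[].
Qed.

Lemma mpolyX_nil : 'X_[mnl n [::]] = 1 :> Pol n.
Proof.
by rewrite -mpolyX0; congr 'X_[_]; apply/mnmP=> i; rewrite mnmE nth_nil mnm0E.
Qed.

(** This is z^w F_c^k with k the length of [w]: the word [w ++ c] whose prefix [w] is already a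
    monomial. *)
Definition mixed w c : Pol n := 'X_[mnl n w] * wordpoly c (drop (size w) zs).

Definition low w m : bool := lexlt (take (size w) m) w.

(** For [c] empty and [w] of length 2n, it rewrites z^w modulo the ideal by smaller monomials. *)
Definition reduces w c : Prop :=
  exists2 g, g \in I & supp_in (low w) (mixed w c - g).

Lemma take_mnl w : (size w <= n.*2)%N -> take (size w) (mnl n w) = w.
Proof.
move=> le_w; have sz : size (take (size w) (mnl n w)) = size w.
  by rewrite size_takel // size_tuple.
apply: (@eq_from_nth _ 0%N) => [//|i]; rewrite sz => lt_i.
rewrite nth_take // -(mnm_nth _ _ (Ordinal (leq_trans lt_i le_w))).
by rewrite mnmE.
Qed.

Lemma mnl_rcons0 w : mnl n (rcons w 0%N) = mnl n w.
Proof.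
apply/mnmP=> i; rewrite !mnmE nth_rcons; case: ltnP => // le_w.
by rewrite if_same nth_default.
Qed.

Lemma mpolyX_rconsS w a (lt_w : (size w < n.*2)%N) :
  'X_[mnl n (rcons w a.+1)] = 'X_(Ordinal lt_w) * 'X_[mnl n (rcons w a)] :> Pol n.
Proof.
rewrite -mpolyXD; congr 'X_[_]; apply/mnmP=> i.
rewrite mnmDE mnm1E !mnmE !nth_rcons -val_eqE /=.
by case: ltngtP.
Qed.

Lemma mixed_rcons0 w c : mixed (rcons w 0%N) c = mixed w (0%N :: c).
Proof.
by rewrite /mixed mnl_rcons0 wordpoly_cons0 size_rcons -drop1 drop_drop add1n.
Qed.

Lemma take_lt_size w m : (size w < n.*2)%N ->
  take (size w).+1 m = rcons (take (size w) m) (nth 0%N m (size w)).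
Proof. by move=> lt_w; rewrite (take_nth 0%N) // size_tuple. Qed.

(** Each use of the recurrence leaves an error term without z_(k+1), where k is the length of [w];
    the factors z_(k+1) taken out earlier are too few to raise its exponent there to a. *)
Lemma mixed_rcons w a c : (size w < n.*2)%N ->
  supp_in (low (rcons w a)) (mixed w (a :: c) - mixed (rcons w a) c).
Proof.
move=> lt_w; set k := size w.
(* Stronger invariant for the induction: the prefix is exactly [w] and the next exponent is below
   a. *)
apply: (@supp_in_sub _ (fun m => (take k m == w) && (nth 0%N m k < a)%N)).
  move=> m /andP[/eqP mw lt_a].
  by rewrite /low size_rcons take_lt_size // mw lexlt_rcons.
have szz : (k < size zs)%N by rewrite size_zvars.
elim: a => [|a IHa]; first by rewrite mixed_rcons0 subrr supp_in0.
have -> : mixed w (a.+1 :: c) - mixed (rcons w a.+1) c =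
    'X_(Ordinal lt_w) * (mixed w (a :: c) - mixed (rcons w a) c) +
    wordpoly (a.+1 :: c) (drop k.+2 zs) * 'X_[mnl n w].
  rewrite /mixed !size_rcons -/k (drop_nth 0 szz) wordpoly_consS.
  rewrite -[behead _]drop1 drop_drop add1n (nth_zvars (Ordinal lt_w)).
  rewrite (mpolyX_rconsS _ lt_w) mulrDr mulrBr !mulrA -addrA addrAC.
  by rewrite ['X_[_] * 'X_(_)]mulrC ['X_[mnl n w] * wordpoly _ _]mulrC addrA.
apply: supp_inD.
  apply: supp_inXM IHa => m /andP[/eqP mw lt_a]; rewrite take_mnmD ?freeU // mw eqxx.
  by rewrite nth_mnmD -(mnm_nth _ _ (Ordinal lt_w)) mnm1E eqxx add1n ltnS.
rewrite mulrC; apply: supp_inXM (free_wordpoly k.+2 _) => m /freeP mP.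
have mP' : free k m by apply/freeP=> i lt_i; apply/mP/(leq_trans lt_i); rewrite -addn2 leq_addr.
rewrite addmC take_mnmD // take_mnl ?eqxx ?(ltnW lt_w) // nth_mnmD (mP k (leqnSn _)).
by rewrite -(mnm_nth _ _ (Ordinal lt_w)) mnmE nth_default.
Qed.

Lemma low_cat w t m : low w m -> low (w ++ t) m.
Proof. by rewrite /low size_cat takeD; apply: lexlt_cat. Qed.

Lemma reduces_rcons w a c : (size w < n.*2)%N ->
  reduces w (a :: c) -> reduces (rcons w a) c.
Proof.
move=> lt_w [g gI gP]; exists g => //.
have -> : mixed (rcons w a) c - g =
    (mixed w (a :: c) - g) - (mixed w (a :: c) - mixed (rcons w a) c).
  by rewrite opprB [RHS]addrC addrA subrK.
rewrite supp_inB ?mixed_rcons // -cats1.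
by apply: supp_in_sub gP => m; apply: low_cat.
Qed.

(** No letter is below 0, so a prefix smaller than w0 is already smaller than w. *)
Lemma reduces_cons0 w c : (size w < n.*2)%N ->
  reduces (rcons w 0%N) c -> reduces w (0%N :: c).
Proof.
move=> lt_w [g gI gP]; exists g => //; rewrite -mixed_rcons0.
apply: supp_in_sub gP => m; rewrite /low size_rcons take_lt_size //.
by apply: lexlt_rcons0; rewrite size_takel // size_tuple ltnW.
Qed.

(** The recurrence is solved for its skipped term. Multiplying by z_(k+1), with k the length of [w],
    leaves the first k exponents alone and so preserves [low w]. *)
Lemma reduces_insert00 w a c : (size w < n.*2)%N ->
    reduces w (a.+1 :: c) -> reduces w (a :: c) ->
  reduces (w ++ [:: 0%N; 0%N]) (a.+1 :: c).
Proof.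
move=> lt_w [g1 g1I g1P] [g2 g2I g2P]; pose x : Pol n := 'X_(Ordinal lt_w).
exists (g1 - x * g2); first by rewrite rpredB ?idealMr.
apply: (@supp_in_sub _ (low w)) => [m|]; first exact: low_cat.
have szz : (size w < size zs)%N by rewrite size_zvars.
have -> : mixed (w ++ [:: 0%N; 0%N]) (a.+1 :: c) =
    mixed w (a.+1 :: c) - x * mixed w (a :: c).
  rewrite -cat_rcons cats1 /mixed !mnl_rcons0 !size_rcons.
  rewrite (drop_nth 0 szz) wordpoly_consS -[behead _]drop1 drop_drop add1n.
  rewrite (nth_zvars (Ordinal lt_w)) mulrDr !mulrA.
  by rewrite [x * 'X_[mnl _ _]]mulrC addrAC subrr add0r.
rewrite opprD addrACA -opprD -mulrBr supp_inB //.
by apply: supp_inXM g2P => m mP; rewrite /low take_mnmD ?freeU.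
Qed.

Lemma reduces_nil w c : reduces w [::] -> reduces w [:: 0%N].
Proof.
by move=> [g gI gP]; exists g => //; rewrite /mixed wordpoly_cons0 !wordpoly_nil in gP *.
Qed.

(** Induction on the length of [w ++ c], then on [w]: letters of the prefix are handed back to the
    word until [w] is empty, where F_c lies in the ideal. Only a pair 00 across the boundary
    obstructs this, and shorter words deal with it. *)
Lemma reduces_not_dyck w c : no00 c -> (size (w ++ c) <= n.*2)%N ->
  ~~ dyck n (w ++ c) -> reduces w c.
Proof.
elim/ltn_ind: {w c}(size (w ++ c)) {-2}w {-2}c (erefl (size (w ++ c))) => T IHT w.
elim/last_ind: w => [|w b IHw] c szT cP le_n not_dyck.
  exists (mixed [::] c); last by rewrite subrr supp_in0.
  have -> : mixed [::] c = wordpoly c zs.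
    by rewrite /mixed drop0 mpolyX_nil mul1r.
  apply: wordpoly_ideal => //; apply: contraR not_dyck; rewrite -eqn0Ngt => /eqP c0.
  apply/forallP=> l; rewrite (leq_trans _ (leq0n l)) // -c0.
  by rewrite -{2}(cat_take_drop l.+1.*2 c) sumn_cat leq_addr.
rewrite cat_rcons in szT le_n not_dyck.
have lt_w : (size w < n.*2)%N.
  by rewrite (leq_trans _ le_n) // size_cat /= addnS ltnS leq_addr.
case bcP : (no00 (b :: c)); first exact/reduces_rcons/IHw.
have [b0 [d c0]] := no00_consF cP bcP.
rewrite {b}b0 {c}c0 in szT cP le_n not_dyck bcP *.
have lt_w0 : (size (rcons w 0%N) < n.*2)%N.
  by rewrite (leq_trans _ le_n) // size_rcons size_cat /= !addnS !ltnS leq_addr.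
have szE k u : (size (w ++ k :: u) < T)%N = (size u <= size d)%N.
  by rewrite -szT !size_cat /= !addnS !ltnS leq_add2l.
have leE k u : (size u <= size d)%N -> (size (w ++ k :: u) <= n.*2)%N.
  move=> le_u; apply: leq_trans le_n; rewrite !size_cat leq_add2l /=.
  by rewrite ltnS leqW.
case: d => [|[|a] d] // in szT cP le_n not_dyck bcP szE leE *.
  (* The word ends with this pair 00, and both zeros are dropped. *)
  apply/reduces_nil/reduces_rcons/reduces_nil => //.
  apply: (IHT (size w)); rewrite ?cats0 ?(ltnW lt_w) //.
    by rewrite -szT size_cat addnS ltnS leq_addr.
  by move: not_dyck; rewrite -cat_rcons cats1 !dyck_rcons0.
(* Both zeros go into the prefix, where they are traded for the shorter words with next letter a + 1
   or a. *)
apply: reduces_cons0 => //; rewrite -cats1 cat_rcons.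
have dP : no00 (a.+1 :: d) by apply: no00_behead cP.
apply: reduces_insert00 => //.
  apply: (IHT _ _ _ _ erefl); rewrite ?szE ?leE //=.
  exact: not_dyck_del00 not_dyck.
case adP : (no00 (a :: d)).
  apply: (IHT _ _ _ _ erefl); rewrite ?szE ?leE //=.
  exact: not_dyck_del00 not_dyck.
(* Lowering the letter has created a new pair 00, which goes into the prefix as well. *)
have [a0 [d' d0]] := no00_consF (no00_behead dP) adP.
rewrite {a}a0 {d}d0 in szT cP le_n not_dyck bcP szE leE dP adP *.
do 2!apply: reduces_cons0 => //; rewrite -cats1 cat_rcons.
apply: (IHT _ _ _ _ erefl); rewrite -?catA ?szE ?leE //=.
  by apply: no00_behead (no00_behead dP).
exact: not_dyck_del00 not_dyck.
Qed.

Lemma span_dyckX m : exists2 q, supp_in (@two_dyck n) q & 'X_[m] - q \in I.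
Proof.
suff H v : size v = n.*2 ->
    exists2 q, supp_in (@two_dyck n) q & 'X_[mnl n v] - q \in I.
  by rewrite -[m]mnl_val; apply: H; rewrite size_tuple.
move: v; apply: lexlt_ind => v sz IH.
case vP : (dyck n v).
  by exists 'X_[mnl n v]; rewrite ?subrr ?rpred0 // supp_inX two_dyck_mnl.
have [g gI] : reduces v [::].
  by apply: reduces_not_dyck; rewrite ?cats0 ?sz ?vP.
rewrite /mixed wordpoly_nil mulr1 => /allP lowP.
have [q qP qI] : exists2 q, supp_in (@two_dyck n) q & ('X_[mnl n v] - g) - q \in I.
  rewrite (mpolyE ('X_[_] - g)); elim: (msupp _) lowP => [|m' s IHs] lowP.
    by exists 0; rewrite ?supp_in0 // big_nil subr0 rpred0.
  have [|q qP qI] := IHs; first by move=> m2 m2s; apply: lowP; rewrite inE m2s orbT.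
  have [|q' q'P q'I] := IH m' (size_mnm _).
    (* At full length, [low] is the lexicographic order itself. *)
    by have := lowP _ (mem_head _ _); rewrite /low take_oversize // size_tuple sz.
  rewrite mnl_val in q'I; exists (('X_[mnl n v] - g)@_m' *: q' + q).
    by rewrite supp_inD ?supp_inZ.
  rewrite big_cons opprD addrACA -scalerBr rpredD //.
  by rewrite -mul_mpolyC idealMr.
by exists q => //; rewrite -(subrK g 'X_[_]) addrAC rpredD.
Qed.

Theorem span_dyck p : exists2 q, supp_in (@two_dyck n) q & p - q \in I.
Proof.
elim/mpolyind: p => [|a m p _ _ [q qP qI]].
  by exists 0; rewrite ?supp_in0 // subr0 rpred0.
have [q' q'P q'I] := span_dyckX m; exists (a *: q' + q).
  by rewrite supp_inD ?supp_inZ.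
by rewrite opprD addrACA -scalerBr rpredD // -mul_mpolyC idealMr.
Qed.

End Spanning.

(** * Counting 2-Dyck vectors *)

Section Counting.
Local Open Scope nat_scope.

(* The number of multisets of size k on n letters. *)
Definition mbin n k := 'C(n + k - 1, k).

(** This is C(n+k-1, k-1), that is k/n times [mbin n k] for n > 0; it puts the fraction of the
    dimension formula into natural numbers. *)
Definition mbin_pred n k := if k is j.+1 then mbin n.+1 j else 0.

Lemma mbinS0 n k : mbin n.+1 k = 'C(n + k, k).
Proof. by rewrite /mbin addSn subn1. Qed.

Lemma mbin0 n : mbin n 0 = 1.
Proof. exact: bin0. Qed.

Lemma mbinS n k : mbin n.+1 k.+1 = mbin n k.+1 + mbin n.+1 k.
Proof. by rewrite !mbinS0 /mbin !addnS subn1 binS. Qed.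

Lemma mbin0S k : mbin 0 k.+1 = 0.
Proof. by rewrite /mbin add0n subn1 bin_small. Qed.

Lemma sum_mbin n k : \sum_(i < k.+1) mbin n i = mbin n.+1 k.
Proof.
elim: k => [|k IH]; first by rewrite big_ord_recr big_ord0 /= !mbin0.
by rewrite big_ord_recr /= IH addnC -mbinS.
Qed.

Lemma sum_mbin_pred n k : \sum_(i < k.+1) mbin_pred n i = mbin_pred n.+1 k.
Proof.
rewrite big_ord_recl add0n; case: k => [|k]; first by rewrite big_ord0.
by rewrite -[RHS]sum_mbin; apply: eq_bigr.
Qed.

Lemma mul_mbin_pred n k : n.+1 * mbin_pred n.+1 k = k * mbin n.+1 k.
Proof.
case: k => [|k]; first by rewrite muln0.
rewrite /= !mbinS0 addnS mul_bin_left; congr (_ * _).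
by rewrite -addSn addnK.
Qed.

Lemma mbin_Vandermonde p q d :
  \sum_(k < d.+1) mbin p k * mbin q (d - k) = mbin (p + q) d.
Proof.
elim: p d => [|p IHp] d.
  rewrite big_ord_recl big1 ?addn0 ?mbin0 ?mul1n ?subn0 // => i _.
  by rewrite mbin0S.
elim: d => [|d IHd]; first by rewrite big_ord_recl big_ord0 !mbin0.
rewrite addSn mbinS -IHd -IHp [LHS]big_ord_recl [X in _ = X + _]big_ord_recl -addnA.
congr (_ + _).
  by rewrite !mbin0.
by rewrite -big_split; apply: eq_bigr => i _; rewrite /= mbinS mulnDl.
Qed.

Lemma mbin_pred_Vandermonde n d :
  \sum_(k < d.+1) mbin_pred n k * mbin n (d - k) = mbin_pred (n + n) d.
Proof.
rewrite big_ord_recl mul0n add0n; case: d => [|d]; first by rewrite big_ord0.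
by rewrite -[RHS]/(mbin (n.+1 + n) d) -mbin_Vandermonde; apply: eq_bigr.
Qed.

(** * Enumeration of 2-Dyck words by bidegree *)

Definition grid k l := [seq (i, j) | i <- iota 0 k.+1, j <- iota 0 l.+1].

Lemma mem_grid k l p : (p \in grid k l) = (p.1 <= k) && (p.2 <= l).
Proof.
apply/allpairsP/andP => [[[i j] []]|[le_k le_l]].
  by rewrite !mem_iota !add0n => lt_i lt_j ->.
by exists p; rewrite !mem_iota !add0n !ltnS; case: p le_k le_l.
Qed.

(** Here [p] is the bidegree of the word without its last pair, which is then forced; [k + l <= n']
    is the only 2-Dyck inequality that involves this pair. *)
Fixpoint dlist n k l : seq (seq nat) :=
  if n is n'.+1 then
    if k + l <= n' then
      [seq rcons (rcons w (k - p.1)) (l - p.2) | p <- grid k l, w <- dlist n' p.1 p.2]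
    else [::]
  else if k + l == 0 then [:: [::]] else [::].

Lemma dlistS n k l : dlist n.+1 k l = if k + l <= n then
  [seq rcons (rcons w (k - p.1)) (l - p.2) | p <- grid k l, w <- dlist n p.1 p.2]
  else [::].
Proof. by []. Qed.

Definition xsum n (v : seq nat) := \sum_(i < n) nth 0 v i.*2.
Definition ysum n (v : seq nat) := \sum_(i < n) nth 0 v i.*2.+1.

Lemma sumn_xysum n v : size v = n.*2 -> sumn v = xsum n v + ysum n v.
Proof.
move=> sz; rewrite sumnE (big_nth 0) sz /xsum /ysum.
elim: n {sz} => [|n IH]; first by rewrite double0 big_nil !big_ord0.
by rewrite doubleS !big_nat_recr //= IH !big_ord_recr /= -addnA addnACA.
Qed.

Lemma xsum_rcons2 n w a b : size w = n.*2 ->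
  xsum n.+1 (rcons (rcons w a) b) = xsum n w + a.
Proof.
move=> sz; rewrite /xsum big_ord_recr /= !nth_rcons !size_rcons sz ltnSn ltnn eqxx.
congr (_ + _); apply: eq_bigr => i _.
have lt_i : i.*2 < n.*2 by rewrite ltn_double.
by rewrite !nth_rcons !size_rcons sz ltnS (ltnW lt_i) lt_i.
Qed.

Lemma ysum_rcons2 n w a b : size w = n.*2 ->
  ysum n.+1 (rcons (rcons w a) b) = ysum n w + b.
Proof.
move=> sz; rewrite /ysum big_ord_recr /= !nth_rcons !size_rcons sz ltnn eqxx.
congr (_ + _); apply: eq_bigr => i _.
have lt_i : i.*2.+1 < n.*2 by rewrite ltn_Sdouble.
by rewrite !nth_rcons !size_rcons sz ltnS (ltnW lt_i) lt_i.
Qed.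

Lemma dyck_rcons2 n w a b : size w = n.*2 ->
  dyck n.+1 (rcons (rcons w a) b) = dyck n w && (sumn w + a + b <= n).
Proof.
move=> sz; rewrite -!cats1 -catA.
apply/forallP/andP => [vP|[/forallP wP le_n] l].
  split.
    apply/forallP=> l; have := vP (widen_ord (leqnSn n) l).
    by rewrite takel_cat //= sz leq_double.
  have := vP ord_max; rewrite take_oversize ?sumn_cat /= ?addn0 ?addnA //.
  by rewrite size_cat sz /= doubleS addn2.
have [lt_l|le_l] := ltnP l n.
  have := wP (Ordinal lt_l).
  by rewrite takel_cat //= sz leq_double.
have -> : l = n :> nat by apply/eqP; rewrite eqn_leq le_l andbT -ltnS.
rewrite take_oversize ?sumn_cat /= ?addn0 ?addnA //.
by rewrite size_cat sz /= doubleS addn2.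
Qed.

Lemma mem_dlist n k l v : (v \in dlist n k l) =
  [&& size v == n.*2, dyck n v, xsum n v == k & ysum n v == l].
Proof.
elim: n k l v => [|n IH] k l v; last rewrite dlistS.
  rewrite /=; have -> : dyck 0 v by apply/forallP=> -[].
  rewrite /xsum /ysum !big_ord0 !(eq_sym 0) -addn_eq0.
  case: (k + l) => [|d] /=; last by rewrite andbF.
  by rewrite inE double0 size_eq0 andbT.
apply/idP/and4P.
  case: ifP => // le_n /allpairsPdep[[i j] [w []]].
  rewrite mem_grid IH /= => /andP[le_i le_j] /and4P[/eqP sz wP /eqP wx /eqP wy] ->.
  rewrite !size_rcons sz doubleS eqxx dyck_rcons2 // xsum_rcons2 // ysum_rcons2 //.
  rewrite wx wy !subnKC // !eqxx wP (sumn_xysum sz) wx wy; split=> //=.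
  by rewrite -addnA addnACA !subnKC.
case/lastP: v => [|v b]; first by case.
case/lastP: v => [|w a]; first by rewrite doubleS => -[].
rewrite !size_rcons doubleS !eqSS => -[/eqP sz].
rewrite dyck_rcons2 // xsum_rcons2 // ysum_rcons2 // (sumn_xysum sz).
move=> /andP[wP le_n] /eqP def_k /eqP def_l.
have -> : k + l <= n by rewrite -def_k -def_l addnACA addnA.
apply/allpairsPdep; exists (xsum n w, ysum n w), w.
rewrite mem_grid IH sz wP !eqxx -def_k -def_l /= !leq_addr; split=> //.
by rewrite !addKn.
Qed.

Lemma dlist_uniq n k l : uniq (dlist n k l).
Proof.
elim: n k l => [|n IH] k l; first by rewrite /=; case: ifP.
rewrite dlistS; case: ifP => // _; apply: allpairs_uniq_dep => [|p _|x1 x2]; rewrite ?IH //.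
  by apply: allpairs_uniq; rewrite ?iota_uniq // => -[i j] [i' j'] _ _ [-> ->].
move=> /allpairsPdep[q [u [_ uP ->]]] /allpairsPdep[q' [u' [_ u'P ->]]] /=.
move=> /rcons_inj[/rcons_inj[uu' _] _]; rewrite -{u'}uu' in u'P *.
move: uP u'P; rewrite !mem_dlist => /and4P[_ _ /eqP ux /eqP uy] /and4P[_ _ /eqP ux' /eqP uy'].
have -> // : q = q' by case: q q' ux uy ux' uy' => [i j] [i' j'] /= <- <- <- <-.
Qed.

Lemma size_dlistS n k l : k + l <= n ->
  size (dlist n.+1 k l) = \sum_(i < k.+1) \sum_(j < l.+1) size (dlist n i j).
Proof.
move=> le_n; rewrite dlistS le_n size_allpairs_dep sumnE big_map.
rewrite big_allpairs_dep -[iota _ k.+1]/(index_iota 0 k.+1) big_mkord.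
by apply: eq_bigr => i _; rewrite -[iota _ l.+1]/(index_iota 0 l.+1) big_mkord.
Qed.

(** For n > 0 this is the formula with factor (n - k - l) / n, free of subtraction and division.
    Strictly inside the range, the hockey-stick identity sums the previous level over the grid. *)
Lemma size_dlist n k l : k + l <= n ->
  size (dlist n k l) + (mbin_pred n k * mbin n l + mbin n k * mbin_pred n l) =
  mbin n k * mbin n l.
Proof.
elim: n k l => [|n IH] k l.
  by rewrite leqn0 addn_eq0 => /andP[/eqP-> /eqP->].
rewrite leq_eqVlt ltnS => /predU1P[def_n|le_n]; last first.
  rewrite size_dlistS // -!sum_mbin -!sum_mbin_pred !big_distrlr /=.
  rewrite -!big_split /=; apply: eq_bigr => i _; rewrite -!big_split /=.
  apply: eq_bigr => j _; apply: IH; rewrite (leq_trans _ le_n) //.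
  by rewrite leq_add // -ltnS ltn_ord.
(* On the boundary k + l = n + 1 the list is empty and the identity says (k + l) / (n + 1) = 1. *)
rewrite /= def_n ltnn add0n; apply/eqP; rewrite -(eqn_pmul2l (ltn0Sn n)); apply/eqP.
rewrite mulnDr mulnA [n.+1 * (_ * mbin_pred _ _)]mulnCA !mul_mbin_pred -mulnA.
by rewrite [X in _ + X]mulnCA -mulnDl def_n.
Qed.

Definition triangle n := [seq (k, d - k) | d <- iota 0 n, k <- iota 0 d.+1].

Definition dall n : seq (seq nat) :=
  [seq v | p <- triangle n, v <- dlist n p.1 p.2].

Lemma triangle_uniq n : uniq (triangle n).
Proof.
apply: allpairs_uniq_dep => [|d _|x1 x2]; rewrite ?iota_uniq //.
move=> /allpairsPdep[d [k [_ le_k ->]]] /allpairsPdep[d' [k' [_ le_k' ->]]] /=.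
move: le_k le_k'; rewrite !mem_iota !add0n !ltnS => le_k le_k' [kk'].
rewrite -{k'}kk' in le_k' * => dd'.
by have -> : d = d' by rewrite -(subnK le_k) dd' subnK.
Qed.

Lemma dall_uniq n : uniq (dall n).
Proof.
apply: allpairs_uniq_dep => [|p _|x1 x2]; rewrite ?triangle_uniq ?dlist_uniq //.
move=> /allpairsPdep[q [u [_ uP ->]]] /allpairsPdep[q' [u' [_ u'P ->]]] /= uu'.
rewrite -{u'}uu' in u'P *.
move: uP u'P; rewrite !mem_dlist => /and4P[_ _ /eqP ux /eqP uy] /and4P[_ _ /eqP ux' /eqP uy'].
have -> // : q = q' by case: q q' ux uy ux' uy' => [i j] [i' j'] /= <- <- <- <-.
Qed.

(** For n = 0 the empty word is 2-Dyck but [triangle] is empty, hence the positivity of n. *)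
Lemma mem_dall n v : 0 < n -> (v \in dall n) = (size v == n.*2) && dyck n v.
Proof.
move=> n_gt0; apply/allpairsPdep/andP => [[p [w [_]]]|[/eqP sz vP]].
  by rewrite mem_dlist => /and4P[sz wP _ _] ->.
exists (xsum n v, ysum n v), v; rewrite mem_dlist sz vP !eqxx; split=> //.
have lt_d : xsum n v + ysum n v < n.
  case: n n_gt0 sz vP => // n _ sz /forallP/(_ ord_max).
  by rewrite take_oversize ?sz // (sumn_xysum sz) ltnS.
apply/allpairsPdep; exists (xsum n v + ysum n v), (xsum n v).
by rewrite !mem_iota /= !add0n lt_d ltnS leq_addr addKn.
Qed.

(** By Vandermonde, each of the two correction terms of [size_dlist] sums to [mbin_pred (n + n) d]
    over the diagonal k + l = d. *)
Lemma sum_size_dlist n d : d <= n ->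
  \sum_(k < d.+1) size (dlist n k (d - k)) + 2 * mbin_pred (n + n) d = mbin (n + n) d.
Proof.
move=> le_dn; rewrite -mbin_Vandermonde mul2n -addnn.
rewrite -{1}mbin_pred_Vandermonde -mbin_pred_Vandermonde.
rewrite [X in _ + (_ + X) = _](reindex_inj rev_ord_inj) /= -!big_split /=.
apply: eq_bigr => i _; have le_i : i <= d by rewrite -ltnS.
rewrite subSS subKn // [mbin_pred n (d - i) * _]mulnC.
by rewrite size_dlist // subnKC.
Qed.

(** With N = n + 1, summing over all degrees gives C(3N-1, N-1) - 2 C(3N-1, N-2), which is 3 C(3N-1,
    N-1) / (2N+1), and 3 C(3N-1, N-1) = C(3N, N). *)
Lemma size_dall n : size (dall n.+1) * (2 * n.+1).+1 = 'C(3 * n.+1, n.+1).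
Proof.
have E : size (dall n.+1) + 2 * mbin_pred (n.+1 + n.+1).+1 n = mbin (n.+1 + n.+1).+1 n.
  rewrite -sum_mbin -sum_mbin_pred big_distrr /= size_allpairs_dep sumnE big_map.
  rewrite big_allpairs_dep -[iota _ n.+1]/(index_iota 0 n.+1) big_mkord -big_split.
  apply: eq_bigr => d _.
  rewrite -[iota _ d.+1]/(index_iota 0 d.+1) big_mkord -[RHS]sum_size_dlist //.
  exact: ltnW.
have K : (2 * n.+1).+1 * mbin_pred (n.+1 + n.+1).+1 n = n * mbin (n.+1 + n.+1).+1 n.
  by rewrite -mul_mbin_pred mul2n addnn.
have F : 3 * mbin (n.+1 + n.+1).+1 n = 'C(3 * n.+1, n.+1).
  apply/eqP; rewrite -(eqn_pmul2l (ltn0Sn n)) -mul_bin_diag; apply/eqP.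
  rewrite mbinS0 mulnA [n.+1 * 3]mulnC; congr (_ * 'C(_, _)).
  by rewrite !mulSn mul0n addn0 addnA [in RHS]addnS.
rewrite -F mulnC; apply/eqP.
rewrite -(eqn_add2r ((2 * n.+1).+1 * (2 * mbin_pred (n.+1 + n.+1).+1 n))) -mulnDr E.
by rewrite mulnCA K mulnA -mulnDl; apply/eqP; congr (_ * _); rewrite mulnS -addSn addnC.
Qed.

End Counting.

(** * The bigraded quotient *)

Section Bidegree.
Variable n : nat.
Implicit Types (m : 'X_{1..n.*2}) (p q : Pol n) (k l : nat).

Lemma bihomogE k l p : bihomog k l p = supp_in (fun m => bideg m == (k, l)) p.
Proof. by []. Qed.

Lemma bidegE m : bideg m = (xsum n m, ysum n m).
Proof.
by rewrite /bideg /xsum /ysum; congr (_, _); apply: eq_bigr => i _;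
   rewrite (mnm_nth 0%N).
Qed.

Lemma bidegD m1 m2 :
  bideg (m1 + m2) = ((bideg m1).1 + (bideg m2).1, (bideg m1).2 + (bideg m2).2)%N.
Proof.
by rewrite /bideg /= -!big_split; congr (_, _); apply: eq_bigr => i _; rewrite mnmDE.
Qed.

Lemma mcoeff_bihomog_comp k l p m :
  (bihomog_comp k l p)@_m = if bideg m == (k, l) then p@_m else 0.
Proof.
rewrite /bihomog_comp raddf_sum /=.
have [mp|mNp] := boolP (m \in msupp p); last first.
  rewrite (memN_msupp_eq0 mNp) if_same big_seq_cond big1 // => m' /andP[m'p _].
  rewrite mcoeffZ mcoeffX; case: eqP => [e|_]; last by rewrite mulr0.
  by rewrite -e m'p in mNp.
rewrite -big_filter; case: eqP => /eqP mkl; last first.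
  rewrite big_seq big1 // => m'; rewrite mem_filter => /andP[m'kl _].
  rewrite mcoeffZ mcoeffX; case: eqP => [e|_]; last by rewrite mulr0.
  by rewrite e (negbTE mkl) in m'kl.
rewrite (bigD1_seq m) ?filter_uniq ?msupp_uniq ?mem_filter ?mkl //=.
rewrite mcoeffZ mcoeffX eqxx mulr1 big1 ?addr0 // => m' m'm.
by rewrite mcoeffZ mcoeffX (negbTE m'm) mulr0.
Qed.

Lemma bihomog_comp_is_linear k l : linear (@bihomog_comp n k l).
Proof.
move=> a p q; apply/mpolyP=> m.
rewrite mcoeffD mcoeffZ !mcoeff_bihomog_comp mcoeffD mcoeffZ.
by case: ifP => _; rewrite ?mulr0 ?addr0.
Qed.

HB.instance Definition _ k l :=
  GRing.isLinear.Build rat (Pol n) (Pol n) *:%R (@bihomog_comp n k l)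
    (bihomog_comp_is_linear k l).

Lemma bihomog_comp_bihomog k l p : bihomog k l (bihomog_comp k l p).
Proof.
apply/allP=> m; rewrite mcoeff_msupp mcoeff_bihomog_comp.
by case: (_ == (k, l)) => //; rewrite eqxx.
Qed.

Lemma bihomog_comp_id k l k' l' p : bihomog k' l' p ->
  bihomog_comp k l p = if (k, l) == (k', l') then p else 0.
Proof.
move=> /supp_inP pP; apply/mpolyP=> m; rewrite mcoeff_bihomog_comp.
rewrite [in RHS](fun_if (mcoeff m)) mcoeff0.
have [->|/pP/eqP->] := eqVneq p@_m 0; first by rewrite !if_same.
by rewrite eq_sym.
Qed.

Lemma bihomogM k l k' l' p q : bihomog k l p -> bihomog k' l' q ->
  bihomog (k + k') (l + l') (p * q).
Proof.
apply: supp_inM => m1 m2 /eqP m1P /eqP m2P.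
by rewrite bidegD m1P m2P.
Qed.

Lemma bihomog1 : bihomog 0 0 (1 : Pol n).
Proof.
rewrite bihomogE -mpolyX0 supp_inX /bideg.
by apply/eqP; congr (_, _); apply: big1 => i _; rewrite mnm0E.
Qed.

Lemma bideg_xvar (i : 'I_n) : bideg U_(xvar i) = (1, 0)%N.
Proof.
congr (_, _).
  rewrite (bigD1 i) //= mnm1E eqxx big1 // => j ji.
  by rewrite mnm1E -val_eqE /= (inj_eq double_inj) val_eqE eq_sym (negbTE ji).
apply: big1 => j _; rewrite mnm1E -val_eqE /=.
by case: eqP => // /(congr1 odd); rewrite /= !odd_double.
Qed.

Lemma bideg_yvar (i : 'I_n) : bideg U_(yvar i) = (0, 1)%N.
Proof.
congr (_, _); last first.
  rewrite (bigD1 i) //= mnm1E eqxx big1 // => j ji.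
  by rewrite mnm1E -val_eqE /= eqSS (inj_eq double_inj) val_eqE eq_sym (negbTE ji).
apply: big1 => j _; rewrite mnm1E -val_eqE /=.
by case: eqP => // /(congr1 odd); rewrite /= !odd_double.
Qed.

(** The bidegree counts the positions in runs of even, respectively odd, index. *)
Lemma bihomog_Fbq c : exists k l, bihomog k l (Fbq n c).
Proof.
pose d (b : bool) := fun r => (odd (run_of c r) == b : nat).
exists (\sum_(r < sumn c) d false r)%N, (\sum_(r < sumn c) d true r)%N.
rewrite bihomogE /Fbq; case: ifP => _; last exact: supp_in0.
apply: supp_in_sum => m _.
apply: (big_rec3 (fun (p : Pol n) k l => bihomog k l p)); first exact: bihomog1.
move=> r p k l _; apply: bihomogM.
rewrite /zvar /d bihomogE.
by case: (odd _); rewrite supp_inX (bideg_xvar, bideg_yvar).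
Qed.

Lemma bqsym_bihomog_comp k l p : bqsym p -> bqsym (bihomog_comp k l p).
Proof.
move=> [N [a [g [gP ->]]]].
(* The projection keeps or kills each F_c; a zero coefficient in the second case leaves the
   generators unchanged. *)
exists N, (fun i => if bihomog_comp k l (g i) == 0 then 0 else a i), g; split=> //.
rewrite linear_sum; apply: eq_bigr => i _ /=; rewrite linearZ /=.
have [c _ ->] := gP i; have [K [L /bihomog_comp_id->]] := bihomog_Fbq c.
case: eqP => _; last by rewrite eqxx scaler0 scale0r.
by case: eqP => [->|]; rewrite ?scaler0.
Qed.

Lemma bihomog_compXM k l m p : bihomog_comp k l ('X_[m] * p) =
  if ((bideg m).1 <= k)%N && ((bideg m).2 <= l)%N
  then 'X_[m] * bihomog_comp (k - (bideg m).1) (l - (bideg m).2) p else 0.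
Proof.
have bX m2 i2 j2 : bideg m2 = (i2, j2) -> bihomog i2 j2 ('X_[m2] : Pol n).
  by move=> m2E; rewrite bihomogE supp_inX m2E.
case mE: (bideg m) => [i j] /=.
elim/mpolyind: p => [|a m' p _ _ IH]; first by rewrite mulr0 !linear0 mulr0 if_same.
case mE': (bideg m') => [i' j'].
rewrite mulrDr linearD /= {}IH -scalerAr -mpolyXD !linearP /= mulrDr -scalerAr.
rewrite linearZ /= (bihomog_comp_id _ _ (bX _ _ _ mE')).
rewrite (@bihomog_comp_id _ _ (i + i') (j + j')); last by rewrite bX // bidegD mE mE'.
have E (a1 b1 c1 : nat) : (a1 == b1 + c1)%N = (b1 <= a1)%N && (a1 - b1 == c1)%N.
  have [le_b|lt_a] := leqP b1 a1; first by rewrite -{1}(subnKC le_b) eqn_add2l.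
  by rewrite ltn_eqF // ltn_addr.
rewrite !xpair_eqE !E andbACA.
case: ((i <= k)%N && (j <= l)%N); last by rewrite /= scaler0 add0r.
by rewrite /=; case: ifP => _; rewrite ?mulr0 // mpolyXD.
Qed.

(** By linearity the multiplier is a monomial z^m, and a component of z^m g is zero or z^m times a
    component of g, again B-quasisymmetric without constant term. *)
Theorem bqideal_bihomog : bihomog_ideal (@bqideal n).
Proof.
move=> p /asboolP[N [a [g [gP ->]]]] k l.
rewrite linear_sum; apply: rpred_sum => i _ /=.
elim/mpolyind: (a i) => [|b m q _ _ IH]; first by rewrite mul0r linear0 rpred0.
rewrite mulrDl linearD rpredD //= -scalerAl linearZ /= -mul_mpolyC idealMr //.
rewrite bihomog_compXM; case: ifP => _; last exact: rpred0.
rewrite idealMr //; have [gS g0] := gP i; apply/asboolP.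
exists 1%N, (fun=> 1), (fun=> bihomog_comp (k - (bideg m).1) (l - (bideg m).2) (g i)).
rewrite big_ord1 mul1r; split=> // _; split; first exact: bqsym_bihomog_comp.
by rewrite mcoeff_bihomog_comp g0 if_same.
Qed.

End Bidegree.

(** * Bases of the quotient and of its bigraded pieces *)

Section Quotient.
Variable n : nat.
Implicit Types (m : 'X_{1..n.*2}) (p q : Pol n) (k l : nat).

Lemma proj_eq p q : (proj p == proj q) = (p - q \in @bqideal n).
Proof. by rewrite Quotient.idealrBE. Qed.

Lemma proj_eq0 p : (proj p == 0) = (p \in @bqideal n).
Proof. by rewrite -[0](rmorph0 (@proj n)) proj_eq subr0. Qed.

Lemma proj_surj (u : Qn n) : exists p, u = proj p.
Proof. by exists (repr u); rewrite /proj reprK. Qed.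

Lemma Hbi_bigrading : is_bigrading (@Hbi n).
Proof.
split.
- move=> k l; split; first by exists 0; rewrite ?rmorph0 // bihomogE supp_in0.
  move=> a _ _ [p pP ->] [q qP ->]; exists (a *: p + q).
    by rewrite bihomogE supp_inD ?supp_inZ.
  by rewrite rmorphD /= projZ.
- move=> u; have [p ->] := proj_surj u.
  pose N := (\max_(m <- msupp p) ((bideg m).1 + (bideg m).2)).+1%N.
  exists N, (fun k l => proj (bihomog_comp k l p)).
  split; first by move=> k l; exists (bihomog_comp k l p) => //; apply: bihomog_comp_bihomog.
  transitivity (proj (\sum_(k < N) \sum_(l < N) bihomog_comp k l p)); last first.
    by rewrite rmorph_sum; apply: eq_bigr => k _; rewrite rmorph_sum.
  congr proj; apply/mpolyP=> m; rewrite raddf_sum.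
  have [p0|mp] := eqVneq p@_m 0.
    rewrite p0 big1 // => k _; rewrite raddf_sum big1 //= => l _.
    by rewrite mcoeff_bihomog_comp p0 if_same.
  have [i [j mE]] : exists i j, bideg m = (i, j).
    by case: (bideg m) => i j; exists i, j.
  have : ((bideg m).1 + (bideg m).2 < N)%N.
    by rewrite ltnS; apply: leq_bigmax_seq; rewrite // mcoeff_msupp.
  rewrite mE => lt_N; have lt1 := leq_ltn_trans (leq_addr _ _) lt_N.
  have lt2 := leq_ltn_trans (leq_addl _ _) lt_N.
  rewrite (bigD1 (Ordinal lt1)) //= raddf_sum (bigD1 (Ordinal lt2)) //=.
  rewrite mcoeff_bihomog_comp mE eqxx big1 ?addr0 => [|l lj]; last first.
    rewrite mcoeff_bihomog_comp mE; case: eqP => // -[e].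
    by case/eqP: lj; apply: val_inj; rewrite /= e.
  rewrite big1 ?addr0 // => k ki; rewrite raddf_sum big1 //= => l _.
  rewrite mcoeff_bihomog_comp mE; case: eqP => // -[e _].
  by case/eqP: ki; apply: val_inj; rewrite /= e.
- move=> N h hP h0 k l lt_k lt_l.
  (* Bihomogeneous lifts are chosen for all components; their sum lies in the ideal, hence so does
     each component of that sum. *)
  have /choice[f fP] : forall kl : nat * nat, exists p, bihomog kl.1 kl.2 p /\ h kl.1 kl.2 = proj p.
    by move=> [i j]; have [p p1 p2] := hP i j; exists p.
  pose s := \sum_(i < N) \sum_(j < N) f (i : nat, j : nat).
  have sI : s \in @bqideal n.
    rewrite -proj_eq0 -h0 /s rmorph_sum; apply/eqP; apply: eq_bigr => i _.
    by rewrite rmorph_sum; apply: eq_bigr => j _; case: (fP (i : nat, j : nat)).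
  have [f1 /= ->] := fP (k, l); apply/eqP; rewrite proj_eq0.
  suff <- : bihomog_comp k l s = f (k, l) by apply: bqideal_bihomog.
  rewrite linear_sum (bigD1 (Ordinal lt_k)) //= linear_sum (bigD1 (Ordinal lt_l)) //=.
  have E i j := bihomog_comp_id k l (fP (i, j)).1.
  rewrite E eqxx big1 ?addr0 => [|j jl]; last first.
    rewrite E; case: eqP => // -[e]; case/eqP: jl; exact: val_inj.
  rewrite big1 ?addr0 // => i ik; rewrite linear_sum big1 //= => j _.
  by rewrite E; case: eqP => // -[e _]; case/eqP: ik; apply: val_inj.
- by exists 1; rewrite ?rmorph1 // bihomog1.
- move=> k l k' l' _ _ [p pP ->] [q qP ->].
  by exists (p * q); rewrite ?rmorphM // bihomogM.
Qed.

(** Shared by the whole quotient and its bigraded pieces: independence follows from [dyck_ideal0]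
    for any family of distinct 2-Dyck exponents, and spanning is supplied for each [U]. *)
Lemma dyck_monomials_basis (I : eqType) (f : I -> 'X_{1..n.*2}) (U : Qn n -> Prop) :
    injective f -> (forall i, two_dyck (f i)) -> (forall i, U (proj 'X_[f i])) ->
    (forall u, U u -> exists2 q, u = proj q & forall m, m \in msupp q -> exists i, m = f i) ->
  is_basis_of U (fun i => proj 'X_[f i]).
Proof.
move=> f_inj fP fU Uspan; split=> //.
  move=> s a s_uniq; pose p : Pol n := \sum_(i <- s) a i *: 'X_[f i].
  have -> : \sum_(i <- s) a i *: proj 'X_[f i] = proj p.
    by rewrite rmorph_sum; apply: eq_bigr => i _; rewrite /= projZ.
  move=> /eqP; rewrite proj_eq0 => /dyck_ideal0 p0 i si.
  have : p = 0 by apply: p0; apply: supp_in_sum => j _; rewrite supp_inZ // supp_inX.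
  move=> /(congr1 (mcoeff (f i))); rewrite mcoeff0 raddf_sum (bigD1_seq i) //=.
  rewrite mcoeffZ mcoeffX eqxx mulr1 big1 ?addr0 // => j ji.
  by rewrite mcoeffZ mcoeffX (inj_eq f_inj) (negbTE ji) mulr0.
move=> u /Uspan[q -> qP].
exists (size (msupp q)), (fun i => q@_(nth 0%MM (msupp q) i)),
  (fun i => proj 'X_[nth 0%MM (msupp q) i]); split.
  by move=> i; have [j ->] := qP _ (mem_nth 0%MM (ltn_ord i)); exists j.
rewrite {1}[q]mpolyE rmorph_sum (big_nth 0%MM) big_mkord.
by apply: eq_bigr => i _; rewrite /= projZ.
Qed.

Lemma has_dim_dyck (L : seq (seq nat)) (U : Qn n -> Prop) :
    uniq L -> (forall v, v \in L -> size v = n.*2 /\ dyck n v) ->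
    (forall v, v \in L -> U (proj 'X_[mnl n v])) ->
    (forall u, U u -> exists2 q, u = proj q & forall m, m \in msupp q -> (m : seq nat) \in L) ->
  has_dim U (size L).
Proof.
move=> L_uniq LP LU Uspan.
have Li (i : 'I_(size L)) : nth [::] L i \in L by apply: mem_nth.
exists (fun i => proj 'X_[mnl n (nth [::] L i)]).
apply: (@dyck_monomials_basis _ (fun i : 'I_(size L) => mnl n (nth [::] L i))).
- move=> i j /(congr1 (fun m : 'X_{1..n.*2} => m : seq nat)).
  have [szi _] := LP _ (Li i); have [szj _] := LP _ (Li j).
  by rewrite !mnlK // => /eqP; rewrite nth_uniq // => /eqP /val_inj.
- by move=> i; have [sz ?] := LP _ (Li i); rewrite two_dyck_mnl.
- by move=> i; apply: LU.
- move=> u /Uspan[q -> qP]; exists q => // m /qP mL.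
  have lt_i : (index (m : seq nat) L < size L)%N by rewrite index_mem.
  by exists (Ordinal lt_i); rewrite /= nth_index // mnl_val.
Qed.

End Quotient.

Lemma dlist_dimE n k l : (0 < n)%N -> (k + l <= n)%N ->
  (size (dlist n k l))%:R = 'C(n + k - 1, k)%:R * 'C(n + l - 1, l)%:R
                            * ((n%:R - k%:R - l%:R) / n%:R) :> rat.
Proof.
case: n => // n _ le_n.
have n0 : n.+1%:R != 0 :> rat by rewrite Num.Theory.pnatr_eq0.
rewrite -/(mbin n.+1 k) -/(mbin n.+1 l).
pose B i : rat := (mbin n.+1 i)%:R; pose G i : rat := (mbin_pred n.+1 i)%:R.
have GE i : n.+1%:R * G i = i%:R * B i by rewrite -!natrM mul_mbin_pred.
have := congr1 (fun d => d%:R : rat) (size_dlist le_n).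
rewrite natrD natrD !natrM -/(B k) -/(B l) -/(G k) -/(G l).
set s := (size _)%:R => E.
(* Multiplication by n + 1 turns each [G i] into i times [B i] and clears the denominator. *)
apply: (mulfI n0).
have -> : n.+1%:R * s = n.+1%:R * (B k * B l) - n.+1%:R * G k * B l - n.+1%:R * G l * B k.
  by rewrite -E; ring.
by rewrite !GE [RHS]mulrCA [n.+1%:R * (_ / _)]mulrC divfK //; ring.
Qed.

Theorem theorem2 (n : nat) (n_ge1 : (1 <= n)%N) :
  [/\ is_basis_of (full_space (Qn n)) (@dyck_monomials n),
      exists2 d : nat, has_dim (full_space (Qn n)) d
        & d%:R = 1 / (2 * n + 1)%N%:R * 'C(3 * n, n)%:R :> rat,
      bihomog_ideal (@bqideal n),
      is_bigrading (@Hbi n)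
    & forall k l : nat,
        ((k + l <= n)%N ->
           exists2 d : nat, has_dim (@Hbi n k l) d
             & d%:R = 'C(n + k - 1, k)%:R * 'C(n + l - 1, l)%:R
                      * ((n%:R - k%:R - l%:R) / n%:R) :> rat)
        /\ ((n < k + l)%N -> has_dim (@Hbi n k l) 0)].
Proof.
have full (u : Qn n) : full_space (Qn n) u ->
    exists2 q, u = proj q & forall m, m \in msupp q -> two_dyck m.
  move=> _; have [p ->] := proj_surj u; have [q /allP qP pq] := span_dyck p.
  by exists q => //; apply/eqP; rewrite proj_eq.
(* Proved for all k and l: when n < k + l the list is empty, which gives dimension 0. *)
have dimH k l : has_dim (@Hbi n k l) (size (dlist n k l)).
  apply: has_dim_dyck => [|v|v|u [p pkl ->]]; first exact: dlist_uniq.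
  - by rewrite mem_dlist => /and4P[/eqP sz vP _ _].
  - rewrite mem_dlist => /and4P[/eqP sz vP /eqP vx /eqP vy].
    exists 'X_[mnl n v] => //; rewrite bihomogE supp_inX.
    by rewrite bidegE mnlK // vx vy.
  (* The 2-Dyck representative q may fail to be bihomogeneous; its (k, l) component remains
     congruent to p because the ideal is bihomogeneous, and keeps 2-Dyck exponents. *)
  - have [q /supp_inP qP pq] := span_dyck p; exists (bihomog_comp k l q).
      apply/eqP; rewrite proj_eq.
      have -> : p = bihomog_comp k l p by rewrite (bihomog_comp_id _ _ pkl) eqxx.
      by rewrite -linearB /=; apply: bqideal_bihomog.
    move=> m; rewrite mcoeff_msupp mcoeff_bihomog_comp.
    case: (bideg m =P (k, l)) => [mkl /qP mP|_]; last by rewrite eqxx.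
    move: mkl; rewrite bidegE mem_dlist size_tuple -two_dyckE mP eqxx => -[-> ->].
    by rewrite !eqxx.
split.
- apply: dyck_monomials_basis => // [|[v vP] //|u /full[q -> qP]]; first exact: val_inj.
  by exists q => // m /qP mP; exists (exist _ m mP).
- exists (size (dall n)).
    apply: has_dim_dyck => [|v|//|u /full[q -> qP]]; first exact: dall_uniq.
      by rewrite mem_dall // => /andP[/eqP].
    by exists q => // m /qP mP; rewrite mem_dall // size_tuple -two_dyckE mP eqxx.
  case: n n_ge1 {full dimH} => // n _.
  rewrite -size_dall addn1 natrM mulrCA div1r mulVf ?mulr1 //.
  by rewrite Num.Theory.pnatr_eq0.
- exact: bqideal_bihomog.
- exact: Hbi_bigrading.
- move=> k l; split=> [le_n|lt_n].
    by exists (size (dlist n k l)); rewrite ?dlist_dimE.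
  have := dimH k l; case: n n_ge1 lt_n {full dimH} => // n _ lt_n.
  by rewrite dlistS leqNgt ltnW.
Qed.
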